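(* Let $P_0=(p^0_{ij})_{i,j\in\mathcal{S}}$ be an irreducible $\ell\times\ell$ matrix with $p^0_{ij}\in\{0,1\}$ for all $i,j$, and let $p^0=(p^0_0,\dots,p^0_{\ell-1})$ be a row vector with $p^0_i\in\{0,1\}$ for all $i$ and $p^0\neq(0,\dots,0)$. Define the compact set $$K=\bigcap_{n\ge1}\ \bigcup_{p^0_{\varepsilon_1}p^0_{\varepsilon_1\varepsilon_2}\cdots p^0_{\varepsilon_{n-1}\varepsilon_n}=1}\overline{I_{\varepsilon_1\cdots\varepsilon_n}}.$$ Let $\delta=\dim_H(K)$ and let $m$ be a measure with support $K$, driven by a Markov chain $X$ with irreducible transition matrix $P$. Then $\dim m=\delta$ if and only if $$P=\frac{1}{\lambda_0}D_0^{-1}P_0D_0,$$ where $\lambda_0$ is the spectral radius of $P_0$ and $D_0$ is the diagonal matrix whose diagonal entries are the coordinates of the (unique) probability vector $\pi_0$ satisfying $P_0\pi_0=\lambda_0\pi_0$. Moreover, the case $P=\frac{1}{\lambda_0}D_0^{-1}P_0D_0$ is the only case where $m$ is monofractal (that is, $m$ is monofractal if and only if $P=\frac{1}{\lambda_0}D_0^{-1}P_0D_0$).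
   Context: Let $\ell\ge 2$ be an integer and $\mathcal{S}=\{0,1,\dots,\ell-1\}$. For $n\ge1$ and a word $\varepsilon_1\cdots\varepsilon_n\in\mathcal{S}^n$ let $I_{\varepsilon_1\cdots\varepsilon_n}=\big[\sum_{i=1}^n\varepsilon_i\ell^{-i},\ \sum_{i=1}^n\varepsilon_i\ell^{-i}+\ell^{-n}\big)$; $\mathcal{F}_n$ is the set of these intervals, $I_n(x)$ is the unique element of $\mathcal{F}_n$ containing $x\in[0,1)$, $|I|$ is the length of $I$, and $\overline{I}$ its closure. Given a probability vector $(p_i)_{i\in\mathcal{S}}$ (initial distribution) and a stochastic matrix $P=(p_{ij})_{i,j\in\mathcal{S}}$ (transition matrix), always assumed to satisfy $p_{ij}\neq 1$ for all $i,j$, the measure driven by the corresponding Markov chain is the unique Borel probability measure $m$ carried by $[0,1)$ with $m(I_{\varepsilon_1\cdots\varepsilon_n})=p_{\varepsilon_1}p_{\varepsilon_1\varepsilon_2}\cdots p_{\varepsilon_{n-1}\varepsilon_n}$ for all words. Its support is its closed topological support. A nonnegative matrix $A$ is irreducible if for all $i,j$ there is $n\ge1$ with $(A^n)_{ij}>0$. For a Borel probability measure $\mu$: $\dim_*\mu=\inf\{\dim_H E: E\text{ Borel},\mu(E)>0\}$, $\dim^*\mu=\inf\{\dim_H E:E\text{ Borel},\mu(E)=1\}$; $\dim\mu$ is the common value when they coincide (which is the case for measures driven by Markov chains with irreducible transition matrix). For real $\alpha$ let $E_\alpha(\mu)=\{x\in[0,1):\lim_{n\to\infty}\log\mu(I_n(x))/\log|I_n(x)|=\alpha\}$;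 $\mu$ is multifractal if $E_\alpha(\mu)\ne\emptyset$ for at least two real values of $\alpha$, and monofractal if $E_\alpha(\mu)\neq\emptyset$ for exactly one real $\alpha$. *)

(* Defs.v *)
From mathcomp Require Import all_boot all_order all_algebra.
From mathcomp Require Import all_classical all_reals all_analysis.
From mathcomp Require Import complex.

Set Implicit Arguments.
Unset Strict Implicit.
Unset Printing Implicit Defensive.

Import Order.TTheory GRing.Theory Num.Theory.
Import numFieldNormedType.Exports.

Local Open Scope classical_set_scope.
Local Open Scope ring_scope.

Definition is_prob_vec (R : realType) (l : nat) (v : 'I_l -> R) : Prop :=
  (forall i, 0 <= v i) /\ \sum_i v i = 1.

Definition stochastic (R : realType) (l : nat) (P : 'M[R]_l) : Prop :=
  forall i, is_prob_vec (P i).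

Definition irreducible_mx (R : realType) (l : nat) (A : 'M[R]_l) : Prop :=
  forall i j, exists2 n, (0 < n)%N & 0 < (A ^+ n) i j.

(* [eigenvalue] only sees eigenvalues in the base field, hence the extension
   of scalars to R[i]. *)
Definition spectral_radius (R : realType) (l : nat) (A : 'M[R]_l) : R :=
  sup [set ComplexField.Normc.normc z | z in
        [set z : R[i] |
          eigenvalue (map_mx (real_complex R) A) z]].

(* [word_weight p P [:: e1; ...; en]] is p_e1 * p_(e1 e2) * ... *)
Fixpoint path_weight (R : realType) (l : nat) (P : 'M[R]_l) (i : 'I_l)
    (w : seq 'I_l) : R :=
  if w is j :: w' then P i j * path_weight P j w' else 1.

Definition word_weight (R : realType) (l : nat) (p : 'rV[R]_l) (P : 'M[R]_l)
    (w : seq 'I_l) : R :=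
  if w is i :: w' then p 0 i * path_weight P i w' else 1.

Definition cylinder_left (R : realType) (l n : nat) (w : n.-tuple 'I_l) : R :=
  \sum_(i < n) (tnth w i)%:R / l%:R ^+ i.+1.

Definition cylinder (R : realType) (l n : nat) (w : n.-tuple 'I_l) : set R :=
  `[cylinder_left R w, cylinder_left R w + l%:R ^- n[.

Definition adic_intervals (R : realType) (l n : nat) : set (set R) :=
  range (fun w : n.-tuple 'I_l => cylinder w).

(* Equal to set0 when x is not in [0, 1[. *)
Definition adic_interval (R : realType) (l n : nat) (x : R) : set R :=
  xget set0 [set J | adic_intervals l n J /\ J x].

Definition markov_compact (R : realType) (l : nat) (p0 : 'rV[R]_l)
    (P0 : 'M[R]_l) : set R :=
  \bigcap_(n in [set n | (0 < n)%N])
    \bigcup_(w in [set w : n.-tuple 'I_l | word_weight p0 P0 w = 1])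
      closure (cylinder w).

Definition markov_driven (R : realType) (l : nat) (p : 'rV[R]_l)
    (P : 'M[R]_l) (m : probability (measurableTypeR R) R) : Prop :=
  m `[0, 1[%classic = 1%E /\
  forall (n : nat) (w : n.-tuple 'I_l), (0 < n)%N ->
    m (cylinder w) = (word_weight p P w)%:E.

Definition measure_support (R : realType)
    (m : probability (measurableTypeR R) R) : set R :=
  [set x | forall U : set R, open U -> U x -> (0 < m U)%E].

Definition diameter (R : realType) (U : set R) : \bar R :=
  ereal_sup [set `|z.1 - z.2|%:E | z in U `*` U].

(* The empty set contributes 0 for every s, including s = 0. *)
Definition hausdorff_gauge (R : realType) (s : R) (U : set R) : \bar R :=
  if U == set0 then 0%E else poweR (diameter U) s.

Definition hausdorff_premeasure (R : realType) (s d : R) (E : set R) : \bar R :=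
  ereal_inf [set (\sum_(0 <= k <oo) hausdorff_gauge s (U k))%E | U in
    [set U : nat -> set R | E `<=` \bigcup_k U k /\
                            forall k, (diameter (U k) <= d%:E)%E]].

Definition hausdorff_measure (R : realType) (s : R) (E : set R) : \bar R :=
  ereal_sup [set hausdorff_premeasure s d E | d in [set d : R | 0 < d]].

Definition hausdorff_dim (R : realType) (E : set R) : \bar R :=
  ereal_inf [set s%:E | s in
    [set s : R | 0 <= s /\ hausdorff_measure s E = 0%E]].

Definition lower_dim (R : realType) (m : probability (measurableTypeR R) R) :
    \bar R :=
  ereal_inf [set hausdorff_dim E | E in
    [set E : set (measurableTypeR R) | measurable E /\ (0 < m E)%E]].

Definition upper_dim (R : realType) (m : probability (measurableTypeR R) R) :
    \bar R :=
  ereal_inf [set hausdorff_dim E | E in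
    [set E : set (measurableTypeR R) | measurable E /\ m E = 1%E]].

Definition is_dim (R : realType) (m : probability (measurableTypeR R) R)
    (d : \bar R) : Prop :=
  lower_dim m = d /\ upper_dim m = d.

(* The quotient is taken in \bar R: lne 0 = -oo, so the limit is +oo, and not
   a real, at points having some null l-adic neighbourhood I_n(x). *)
Definition level_set (R : realType) (l : nat)
    (m : probability (measurableTypeR R) R) (a : R) : set R :=
  [set x | 0 <= x < 1 /\
    (lne (m (adic_interval l n x)) /
     lne (lebesgue_measure (adic_interval l n x)))%E @[n --> \oo] --> a%:E].

Definition monofractal (R : realType) (l : nat)
    (m : probability (measurableTypeR R) R) : Prop :=
  exists! a : R, level_set l m a !=set0.

(* Main.v *)
(** Let Q be the matrix on the right-hand side, i.e. [Q i j = P0 i j * pi_j / (lambda0 * pi_i)].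
    It is stochastic and its word weights are comparable to [lambda0 ^ (- n)] on the words
    allowed by [P0], so covering by cylinders and the mass distribution principle give
    [dim K = s] with [s = ln lambda0 / ln l]; for the lower bound, compactness of [K] replaces
    the existence of a measure with these weights. The equality [supp m = K] forces [P] and
    [P0] to have the same positive entries.

    If [P = Q], all local dimensions of [m] are [s] and so is [dim m]. If [P <> Q], the matrix
    of entries [sqrt (P i j * Q i j)] has row sums at most 1, not all equal to 1, hence spectral
    radius less than 1; so [m] gives exponentially small mass to the cylinders of generation n
    of mass less than [l ^ (- n s')], for some [s' < s], and is carried by a set of dimension at
    most [s']. If [m] is monofractal, comparing the local dimensions at periodic points shows
    that [P i j = t * g j / g i] on allowed transitions; then [g] is a positive eigenvector of
    [P0], so that [P = Q]. *)

Require Import Defs.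
From mathcomp Require Import finmap.
From mathcomp Require Import all_boot all_order all_algebra.
From mathcomp Require Import all_classical all_reals all_analysis.
From mathcomp Require Import measurable_realfun complex ring lra zify.
Set Implicit Arguments.
Unset Strict Implicit.
Unset Printing Implicit Defensive.
Import Order.TTheory GRing.Theory Num.Theory.
Import numFieldNormedType.Exports.
Local Open Scope classical_set_scope.
Local Open Scope ring_scope.

(** * Perron-Frobenius theory *)

(** Closed cylinders of one generation share endpoints, so membership in [K] or in the support
    identifies a word only at a point interior to its cylinder; and a word ending in the digit
    [l - 1] forever codes a point that leaves its own half-open cylinders. Where this matters,
    points are built from infinite words whose later digits are controlled.

    An irreducible matrix may be periodic, so its powers need not become positive. Estimates are
    read off positive eigenvectors instead, and pairing a left with a right eigenvector replaces
    convergence of powers.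

    The square root is the geometric mean for which the deficit of the row sums is a sum of squares,
    which settles its equality case, and its word weights are geometric means of those of [P] and
    [Q].

    The condition [P i j <> 1] enters twice: it gives [2 <= lambda0], so that [s] is positive and
    there is room below it, and it lets an infinite word avoid the digit [l - 1], which shows that a
    level set is nonempty when [P = Q]. *)

Lemma finite_lbound (R : realType) (I : finType) (f : I -> R) :
  (forall i, 0 < f i) -> exists2 e, 0 < e & forall i, e <= f i.
Proof.
move=> f0; have S0 : 0 <= \sum_i (f i)^-1.
  by apply: sumr_ge0 => i _; rewrite invr_ge0 ltW.
(* The term 1 keeps the bound positive when [I] is empty. *)
exists (1 + \sum_i (f i)^-1)^-1; first by rewrite invr_gt0 ltr_wpDr.
move=> i; rewrite invf_ple ?posrE ?ltr_wpDr//.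
rewrite (bigD1 i)//= addrCA lerDl addr_ge0// sumr_ge0// => j _.
by rewrite invr_ge0 ltW.
Qed.

(* Irreducibility in the form used for nonnegative matrices: no proper nonempty set of
   states is closed under predecessors. *)
Definition path_closed (R : realType) (l : nat) (A : 'M[R]_l) : Prop :=
  forall S : set 'I_l, S !=set0 ->
    (forall i j, S j -> 0 < A i j -> S i) -> forall i, S i.

Lemma mulmx_ge0 (R : realType) (m n k : nat) (A : 'M[R]_(m, n)) (B : 'M[R]_(n, k)) :
  (forall i j, 0 <= A i j) -> (forall i j, 0 <= B i j) ->
  forall i j, 0 <= (A *m B) i j.
Proof. by move=> A0 B0 i j; rewrite mxE sumr_ge0// => h _; rewrite mulr_ge0. Qed.

Lemma expmx_ge0 (R : realType) (l : nat) (A : 'M[R]_l) (n : nat) :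
  (forall i j, 0 <= A i j) -> forall i j, 0 <= (A ^+ n) i j.
Proof.
move=> A0; elim: n => [|n IH] i j; first by rewrite expr0 mxE ler0n.
by rewrite exprS; apply: mulmx_ge0.
Qed.

Lemma irreducible_path_closed (R : realType) (l : nat) (A : 'M[R]_l) :
  (forall i j, 0 <= A i j) -> irreducible_mx A -> path_closed A.
Proof.
move=> A0 irrA S [j Sj] clS i; have [n _] := irrA i j.
elim: n i => [|n IH] i.
  rewrite expr0 mxE; case: eqP => [->//|_]; by rewrite ltxx.
rewrite exprS mxE lt0r psumr_neq0 => [/andP[/hasP[k _ /= h] _]|k _]; last first.
  by rewrite mulr_ge0// expmx_ge0.
move: h; rewrite lt0r mulf_eq0 negb_or -andbA => /and3P[Aik Ank _].
apply: (clS _ k); last by rewrite lt_neqAle eq_sym Aik A0.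
by apply: IH; rewrite lt_neqAle eq_sym Ank expmx_ge0.
Qed.

(** The complement of a set closed under successors is closed under predecessors. *)
Lemma path_closed_tr (R : realType) (l : nat) (A : 'M[R]_l) :
  path_closed A -> path_closed A^T.
Proof.
move=> pA S [i Si] clS; apply: contrapT => /existsNP[j Sj].
apply: (pA (~` S) (ex_intro _ j Sj) _ i) => // h k Sk Ahk Sh.
by apply: Sk; apply: (clS _ h); rewrite // mxE.
Qed.

Lemma path_closed_support (R : realType) (l : nat) (A B : 'M[R]_l) :
  (forall i j, 0 < A i j -> 0 < B i j) -> path_closed A -> path_closed B.
Proof. by move=> AB pA S S0 clS; apply: pA => // i j Sj /AB; apply: clS. Qed.

(** If [i] had no successor, the complement of [i] would be closed under predecessors; it is
    nonempty because [2 <= l]. *)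
Lemma path_closed_row (R : realType) (l : nat) (A : 'M[R]_l) (i : 'I_l) :
  (2 <= l)%N -> path_closed A -> exists j, 0 < A i j.
Proof.
move=> l2 pA; apply: contrapT => /forallNP Ai.
have [j ji] : exists j : 'I_l, j <> i.
  have l1 : (1 < l)%N := l2; have l0 : (0 < l)%N := ltnW l2.
  have [i0|i0] := eqVneq (i : nat) 0%N.
    by exists (Ordinal l1) => /(congr1 val)/=; rewrite i0.
  by exists (Ordinal l0) => /(congr1 val)/= E; rewrite -E in i0.
apply: (pA [set k | k <> i] (ex_intro _ j ji)) (erefl i) => h k _ Ahk hi.
by apply: (Ai k); rewrite -hi.
Qed.

(** Adding the identity makes the iterates increase coordinatewise, so positivity is never lost,
    even for periodic [A]. The coordinates that become positive at some time are closed under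
    predecessors. *)
Lemma expmx_pos (R : realType) (l : nat) (A : 'M[R]_l) (z : 'cV[R]_l) :
  (forall i j, 0 <= A i j) -> path_closed A ->
  (forall i, 0 <= z i 0) -> z != 0 ->
  exists N, forall i, 0 < ((1%:M + A) ^+ N *m z) i 0.
Proof.
move=> A0 pA z0 zN0; pose y N := (1%:M + A) ^+ N *m z.
have M0 i j : 0 <= (1%:M + A) i j by rewrite mxE addr_ge0// mxE ler0n.
have y0 N i : 0 <= y N i 0.
  by apply: mulmx_ge0 => [|j k]; [exact: expmx_ge0|rewrite ord1].
have yS N : y N.+1 = y N + A *m y N.
  by rewrite /y exprS -mulmxE -mulmxA mulmxDl mul1mx.
have yle N i : y N i 0 <= y N.+1 i 0.
  by rewrite yS [leRHS]mxE lerDl; apply: mulmx_ge0 => // j k; rewrite ord1.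
have ymono N N' i : (N <= N')%N -> y N i 0 <= y N' i 0.
  by move=> /subnK<-; elim: (N' - N)%N => // k IH; rewrite addSn (le_trans IH).
have Sall : forall i, exists N, 0 < y N i 0.
  apply: pA => [|i j [N yN] Aij].
    have /cV0Pn[i zi] := zN0; exists i, 0%N.
    by rewrite /y expr0 mul1mx lt_neqAle eq_sym zi z0.
  exists N.+1; rewrite yS [ltRHS]mxE ltr_wpDl// mxE (bigD1 j)//= ltr_wpDr ?mulr_gt0//.
  by rewrite sumr_ge0// => k _; rewrite mulr_ge0.
have [f fP] := choice Sall; exists (\max_i f i)%N => i.
exact: lt_le_trans (fP i) (ymono _ _ _ (leq_bigmax i)).
Qed.

(* Collatz-Wielandt: a maximiser [(x, r)] of [r] under [r x <= A x] on the simplex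
   satisfies equality, since otherwise multiplying [x] by a power of [1 + A] makes every
   coordinate inequality strict. *)
Lemma perron_eigenvector (R : realType) (l : nat) (A : 'M[R]_l) :
  (0 < l)%N -> (forall i j, 0 <= A i j) -> path_closed A ->
  exists2 v : 'cV[R]_l, (forall i, 0 <= v i 0) /\ v != 0 &
    exists2 r, 0 <= r & A *m v = r *: v.
Proof.
(* Summing the constraints over [i] on the simplex bounds every admissible [r] by [B], so the
   maximisation takes place on a compact set. *)
move=> l0 A0 pA; pose B := \sum_i \sum_j A i j.
have B0 : 0 <= B by rewrite sumr_ge0// => i _; rewrite sumr_ge0.
pose box := [set x : 'rV[R]_l | forall i, `[0, 1]%classic (x ord0 i)].
pose C := [set z : 'rV[R]_l * R | (box `*` `[0, B]%classic) z /\
  ((\sum_i z.1 0 i) = 1 /\ forall i, z.2 * z.1 0 i <= \sum_j A i j * z.1 0 j)].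
have cbox : compact (box `*` `[0, B]%classic).
  apply: compact_setX; last exact: segment_compact.
  by apply: (@rV_compact R l (fun=> `[0, 1]%classic)) => i; exact: segment_compact.
have c1 i : continuous (fun z : 'rV[R]_l * R => z.1 0 i).
  move=> z; apply: (@continuous_comp _ _ _ (@fst 'rV[R]_l R) (fun x : 'rV[R]_l => x 0 i)).
    exact: cvg_fst.
  exact: coord_continuous.
have c2 : continuous (fun z : 'rV[R]_l * R => z.2) by move=> z; exact: cvg_snd.
have csum (a : 'I_l -> R) : continuous (fun z : 'rV[R]_l * R => \sum_j a j * z.1 0 j).
  move=> z; apply: (cvg_big _ (Ff := fun j (z : 'rV[R]_l * R) => a j * z.1 0 j)).
    exact: add_continuous.
  by move=> j _; apply: cvgM; [exact: cvg_cst|exact: c1].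
have cC : compact C.
  have Dcl : closed [set z : 'rV[R]_l * R | (\sum_i z.1 0 i) = 1 /\
        forall i, z.2 * z.1 0 i <= \sum_j A i j * z.1 0 j].
    apply: closedI.
      have := @preimage_closed _ _ (fun z : 'rV[R]_l * R => \sum_j 1 * z.1 0 j) [set x | x = 1].
      rewrite /preimage/=; under eq_set do under eq_bigr do rewrite mul1r.
      apply; [by move=> z _; have := csum (fun=> 1) z|exact: closed_eq].
    rewrite (_ : (fun x => _) = \bigcap_(i in setT) [set z : 'rV[R]_l * R |
        0 <= \sum_j A i j * z.1 0 j - z.2 * z.1 0 i]); last first.
      apply/seteqP; split => z h i; first by move=> _ /=; rewrite subr_ge0.
      by rewrite -subr_ge0; exact: h.
    apply: closed_bigI => i _.
    apply: (@preimage_closed _ _ (fun z : 'rV[R]_l * R =>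
       \sum_j A i j * z.1 0 j - z.2 * z.1 0 i) [set x | 0 <= x]); last exact: closed_ge.
    move=> z _; apply: cvgB; first exact: csum.
    by apply: cvgM; [exact: c2|exact: c1].
  have -> : C = (box `*` `[0, B]%classic) `&` [set z : 'rV[R]_l * R | (\sum_i z.1 0 i) = 1 /\
        forall i, z.2 * z.1 0 i <= \sum_j A i j * z.1 0 j] by [].
  exact: compact_closedI.
have inC (y : 'cV[R]_l) (r : R) : (forall i, 0 <= y i 0) -> \sum_i y i 0 = 1 -> 0 <= r ->
    (forall i, r * y i 0 <= (A *m y) i 0) -> C (y^T, r).
  move=> y0 y1 r0 ry.
  have ryB i : y i 0 <= 1.
    by rewrite -y1 (bigD1 i)//= lerDl sumr_ge0.
  split; first split => /=.
  - by move=> i; rewrite /= mxE in_itv/= y0 ryB.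
  - rewrite in_itv/= r0/= -[r]mulr1 -y1 mulr_sumr ler_sum// => i _.
    rewrite (le_trans (ry i))// mxE ler_sum// => j _.
    by rewrite -[leRHS]mulr1 ler_wpM2l.
  split => /=; first by under eq_bigr do rewrite mxE.
  move=> i; have := ry i; rewrite !mxE => /le_trans; apply.
  by rewrite ler_sum// => j _; rewrite mxE.
have C0 : C !=set0.
  pose i0 := Ordinal l0.
  exists ((delta_mx i0 0 : 'cV[R]_l)^T, 0); apply: inC => //.
  - by move=> i; rewrite mxE ler0n.
  - rewrite (bigD1 i0)//= mxE !eqxx big1 ?addr0// => i ii0.
    by rewrite mxE (negbTE ii0).
  - by move=> i; rewrite mul0r; apply: mulmx_ge0 => // j k; rewrite mxE ler0n.
have c2w : {within C, continuous (fun z : 'rV[R]_l * R => z.2)}.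
  exact: continuous_subspaceT.
have [[x r]] := compact_EVT_max C0 cC c2w.
rewrite inE => -[[/= bx rB] [/= x1 rx]] rmax.
have r0 : 0 <= r by move: rB; rewrite in_itv/= => /andP[].
have x0 i : 0 <= x 0 i by have := bx i; rewrite /= in_itv/= => /andP[].
exists x^T.
  split; first by move=> i; rewrite mxE.
  apply/eqP => xT0; move: x1; rewrite big1 => [/eqP|i _]; first by rewrite eq_sym oner_eq0.
  by have /matrixP/(_ i 0) := xT0; rewrite !mxE.
exists r => //; apply/eqP; rewrite -subr_eq0; apply/negPn/negP => zN0.
set z := _ - _ in zN0.
have z0 i : 0 <= z i 0.
  by rewrite !mxE subr_ge0; under eq_bigr do rewrite mxE.
have [N zN] := expmx_pos A0 pA z0 zN0.
pose M := (1%:M + A) ^+ N; pose y := M *m x^T.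
have AM : A *m M = M *m A.
  rewrite mulmxE; apply: (@commrX _ A (1 + A)); apply: commrD => //.
  exact: commr1.
have zy : M *m z = A *m y - r *: y.
  by rewrite /z mulmxBr mulmxA -AM -mulmxA scalemxAr.
have M0 i j : 0 <= M i j.
  by apply: expmx_ge0 => h k; rewrite mxE addr_ge0// mxE ler0n.
have y0 i : 0 <= y i 0 by apply: mulmx_ge0 => // j k; rewrite mxE ord1.
pose Y := \sum_i y i 0.
have Y0 : 0 <= Y by rewrite sumr_ge0.
have [e e0 ze] := finite_lbound zN.
have YN0 : Y != 0.
  apply/negP => /eqP Y00; have : y = 0.
    by apply/colP => i; rewrite [RHS]mxE; apply: (psumr_eq0P _ Y00).
  move=> yE; have := zN (Ordinal l0); rewrite -/M zy yE mulmx0 scaler0 subr0 mxE.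
  by rewrite ltxx.
have Yp : 0 < Y by rewrite lt_neqAle eq_sym YN0.
have sE (a : R) (u : 'cV[R]_l) i : (a *: u) i 0 = a * u i 0 by rewrite mxE.
(* The slack [e] in [A y - r y] allows the gain [e / Y], because each coordinate of [y] is at most
   its total mass [Y]. This contradicts the maximality of [r]. *)
have : C ((Y^-1 *: y)^T, r + e / Y).
  apply: inC.
  - by move=> i; rewrite mxE mulr_ge0// invr_ge0.
  - by under eq_bigr do rewrite mxE; rewrite -mulr_sumr -/Y mulVf.
  - by rewrite addr_ge0// divr_ge0// ltW.
  - move=> i; rewrite -scalemxAr !sE mulrCA ler_wpM2l ?invr_ge0//.
    have : (M *m z) i 0 = (A *m y) i 0 - r * y i 0.
      by rewrite zy -sE [LHS]mxE [X in _ + X]mxE.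
    move=> zi; have := ze i; rewrite zi lerBrDr addrC mulrDl; apply: le_trans.
    rewrite lerD2l mulrAC -mulrA (ler_piMr (ltW e0))// ler_pdivrMr// mul1r.
    by rewrite /Y (bigD1 i)//= lerDl sumr_ge0.
move=> /mem_set/rmax/=; rewrite gerDl leNgt divr_gt0//.
Qed.

Lemma eigvec_pos (R : realType) (l : nat) (A : 'M[R]_l) (v : 'cV[R]_l) (r : R) :
  (forall i j, 0 <= A i j) -> path_closed A ->
  (forall i, 0 <= v i 0) -> v != 0 -> A *m v = r *: v -> forall i, 0 < v i 0.
Proof.
move=> A0 pA v0 vN0 Av; apply: pA => [|i j vj Aij].
  by have /cV0Pn[i vi] := vN0; exists i; rewrite /= lt0r vi v0.
rewrite lt0r v0 andbT; apply/eqP => vi.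
have : (A *m v) i 0 = 0 by rewrite Av mxE vi mulr0.
rewrite mxE => /psumr_eq0P H; have /eqP := H (fun k _ => mulr_ge0 (A0 i k) (v0 k)) j isT.
by rewrite mulf_eq0 !gt_eqF.
Qed.

(** The pairing [y^T A v] equals both [a y^T v] and [b y^T v], and [y^T v] is positive. *)
Lemma eigenvalue_dual (R : realType) (l : nat) (A : 'M[R]_l) (v y : 'cV[R]_l)
    (a b : R) :
  (forall i, 0 <= v i 0) -> v != 0 -> (forall i, 0 < y i 0) ->
  A *m v = a *: v -> A^T *m y = b *: y -> a = b.
Proof.
move=> v0 vN0 y0 Av Ay.
have : y^T *m (A *m v) = (A^T *m y)^T *m v by rewrite trmx_mul trmxK mulmxA.
rewrite Av Ay -scalemxAr linearZ/= -scalemxAl => /matrixP/(_ 0 0).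
rewrite !mxE; apply: mulIf.
have /cV0Pn[i vi] := vN0.
rewrite gt_eqF// (bigD1 i)//= ltr_pwDl//.
  by rewrite mxE mulr_gt0// lt0r vi v0.
by rewrite sumr_ge0// => j _; rewrite mxE mulr_ge0// ltW.
Qed.

Lemma perron (R : realType) (l : nat) (A : 'M[R]_l) :
  (2 <= l)%N -> (forall i j, 0 <= A i j) -> path_closed A ->
  exists r, exists v y : 'cV[R]_l,
    [/\ 0 < r, forall i, 0 < v i 0, forall i, 0 < y i 0,
        A *m v = r *: v & A^T *m y = r *: y].
Proof.
move=> l2 A0 pA; have l0 : (0 < l)%N := ltnW l2.
have AT0 i j : 0 <= A^T i j by rewrite mxE.
have [v [v0 vN0] [r r0 Av]] := perron_eigenvector l0 A0 pA.
have pAT := path_closed_tr pA.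
have [y [y0 yN0] [s s0 Ay]] := perron_eigenvector l0 AT0 pAT.
have vp := eigvec_pos A0 pA v0 vN0 Av.
have yp := eigvec_pos AT0 pAT y0 yN0 Ay.
have rs := eigenvalue_dual v0 vN0 yp Av Ay.
exists r, v, y; split => //; last by rewrite rs.
pose i := Ordinal l0; have [j Aij] := path_closed_row i l2 pA.
have : 0 < r * v i 0.
  have -> : r * v i 0 = (A *m v) i 0 by rewrite Av mxE.
  rewrite mxE (bigD1 j)//= ltr_pwDl ?mulr_gt0//.
  by rewrite sumr_ge0// => k _; rewrite mulr_ge0.
by rewrite pmulr_lgt0.
Qed.

(** For the largest [c] with [c v <= w], the difference [w - c v] is a nonnegative eigenvector with
    a zero coordinate, hence zero by [eigvec_pos]. *)
Lemma perron_unique (R : realType) (l : nat) (A : 'M[R]_l) (v w : 'cV[R]_l) (r : R) :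
  (forall i j, 0 <= A i j) -> path_closed A ->
  (forall i, 0 < v i 0) -> (forall i, 0 < w i 0) ->
  A *m v = r *: v -> A *m w = r *: w -> \sum_i v i 0 = 1 -> \sum_i w i 0 = 1 ->
  v = w.
Proof.
move=> A0 pA v0 w0 Av Aw v1 w1.
have [i0 _] : exists i : 'I_l, True.
  apply: contrapT => nI; move: v1; rewrite big1 => [/eqP|i]; first by rewrite eq_sym oner_eq0.
  by case: nI; exists i.
have [i cmin] : exists i, forall j, w i 0 / v i 0 <= w j 0 / v j 0.
  pose i := [arg min_(i < i0) (w i 0 / v i 0)]%O.
  by exists i; rewrite /i; case: arg_minP => // k _ kP j; apply: kP.
pose c := w i 0 / v i 0; pose u := w - c *: v.
have uE j : u j 0 = w j 0 - c * v j 0 by rewrite !mxE.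
have u0 j : 0 <= u j 0 by rewrite uE subr_ge0 -ler_pdivlMr.
have Au : A *m u = r *: u by rewrite mulmxBr -scalemxAr Av Aw scalerBr !scalerA [c * r]mulrC.
have wcv : w = c *: v.
  apply/eqP; rewrite -subr_eq0; apply/negPn/negP => uN0.
  have := eigvec_pos A0 pA u0 uN0 Au i.
  by rewrite uE /c divfK ?subrr ?ltxx// gt_eqF.
have : c = 1 by rewrite -w1 wcv; under eq_bigr do rewrite mxE; rewrite -mulr_sumr v1 mulr1.
by move=> c1; rewrite wcv c1 scale1r.
Qed.

Lemma normc_real (R : realType) (x : R) : 0 <= x ->
  ComplexField.Normc.normc (real_complex R x) = x.
Proof.
by move=> x0; rewrite /ComplexField.Normc.normc /= expr0n/= addr0 sqrtr_sqr ger0_norm.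
Qed.

Lemma normc_sum (R : realType) (I : Type) (s : seq I) (F : I -> R[i]) :
  ComplexField.Normc.normc (\sum_(i <- s) F i) <=
  \sum_(i <- s) ComplexField.Normc.normc (F i).
Proof.
elim: s => [|i s IH]; first by rewrite !big_nil ComplexField.Normc.normc0.
rewrite !big_cons; apply: le_trans (le_normcD _ _) _.
by rewrite lerD2l.
Qed.

(** Taking moduli in a complex eigenvector equation gives an entrywise inequality; pairing it with
    the positive vector [v] bounds the modulus of the eigenvalue by [r]. *)
Lemma spectral_radius_perron (R : realType) (l : nat) (A : 'M[R]_l)
    (v y : 'cV[R]_l) (r : R) :
  (0 < l)%N -> (forall i j, 0 <= A i j) -> 0 < r ->
  (forall i, 0 < v i 0) -> (forall i, 0 < y i 0) ->
  A *m v = r *: v -> A^T *m y = r *: y -> spectral_radius A = r.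
Proof.
move=> l0 A0 r0 v0 y0 Av Ay; rewrite /spectral_radius.
set S := image _ _.
have Sr : S r.
  exists (real_complex R r); last by rewrite normc_real// ltW.
  (* [eigenvalue] refers to row eigenvectors, so the witness comes from the left eigenvector. *)
  rewrite /= eigenvalue_map; apply/eigenvalueP; exists y^T.
    by apply: trmx_inj; rewrite trmx_mul trmxK Ay linearZ/= trmxK.
  apply/eqP => /matrixP/(_ 0 (Ordinal l0)); rewrite !mxE => /eqP.
  by rewrite gt_eqF.
have ubr : ubound S r.
  move=> _ [z /= /eigenvalueP[u uA uN0] <-].
  pose n (x : R[i]) := ComplexField.Normc.normc x.
  have n0 x : 0 <= n x by case: x => a b; exact: sqrtr_ge0.
  have uj j : n z * n (u 0 j) <= \sum_i n (u 0 i) * A i j.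
    rewrite -[n z * _]ComplexField.Normc.normcM.
    have -> : z * u 0 j = \sum_i u 0 i * real_complex R (A i j).
      have /matrixP/(_ 0 j) := uA; rewrite !mxE => <-.
      by apply: eq_bigr => i _; rewrite mxE.
    apply: le_trans (normc_sum _ _) _; apply: ler_sum => i _.
    by rewrite ComplexField.Normc.normcM normc_real.
  have /rV0Pn[k uk] := uN0.
  have S0 : 0 < \sum_j n (u 0 j) * v j 0.
    rewrite (bigD1 k)//= ltr_pwDl//.
      rewrite mulr_gt0// lt0r n0 andbT; apply/eqP => /ComplexField.Normc.eq0_normc.
      by move/eqP; rewrite (negbTE uk).
    by rewrite sumr_ge0// => j _; rewrite mulr_ge0// ltW.
  rewrite -(ler_pM2r S0) !mulr_sumr.
  apply: (@le_trans _ _ (\sum_j (\sum_i n (u 0 i) * A i j) * v j 0)).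
    by apply: ler_sum => j _; rewrite mulrA ler_wpM2r// ltW.
  under eq_bigr do rewrite mulr_suml.
  rewrite exchange_big/=; apply: ler_sum => i _.
  have /matrixP/(_ i 0) := Av; rewrite !mxE mulrCA => <-.
  by rewrite mulr_sumr; apply: ler_sum => j _; rewrite mulrA.
apply/eqP; rewrite eq_le; apply/andP; split.
  by apply: ge_sup => //; exists r.
by apply: ub_le_sup => //; exists r.
Qed.

(** * Weights of words *)

Section Words.
Variables (R : realType) (l : nat).
Implicit Types (p : 'rV[R]_l) (P Q : 'M[R]_l) (s w : seq 'I_l).

Lemma path_weight_cat P i s1 s2 :
  path_weight P i (s1 ++ s2) = path_weight P i s1 * path_weight P (last i s1) s2.
Proof. by elim: s1 i => [|j s1 IH] i /=; rewrite ?mul1r// IH mulrA. Qed.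

Lemma word_weight_cat p P i s1 s2 :
  word_weight p P (i :: s1 ++ s2) =
  word_weight p P (i :: s1) * path_weight P (last i s1) s2.
Proof. by rewrite /= path_weight_cat mulrA. Qed.

Lemma word_weight_rcons p P s i j :
  word_weight p P (rcons (rcons s i) j) = word_weight p P (rcons s i) * P i j.
Proof.
by case: s => [|k s] /=; rewrite ?mulr1// -(cats1 (rcons s i)) path_weight_cat/=
  last_rcons mulr1 mulrA.
Qed.

Lemma word_weight_rcons_cat p P s i t :
  word_weight p P (rcons s i ++ t) = word_weight p P (rcons s i) * path_weight P i t.
Proof.
case: s => [|k s]; first by rewrite /= mulr1.
by rewrite rcons_cons cat_cons word_weight_cat last_rcons.
Qed.

Lemma path_weight_ge0 P i s : (forall i j, 0 <= P i j) -> 0 <= path_weight P i s.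
Proof. by move=> P0; elim: s i => [|j s IH] i //=; rewrite mulr_ge0. Qed.

Lemma word_weight_ge0 p P w : (forall i, 0 <= p 0 i) -> (forall i j, 0 <= P i j) ->
  0 <= word_weight p P w.
Proof. by move=> p0 P0; case: w => [|i s] //=; rewrite mulr_ge0// path_weight_ge0. Qed.

Lemma word_weight_take_gt0 p P w n :
  (forall i, 0 <= p 0 i) -> (forall i j, 0 <= P i j) ->
  0 < word_weight p P w -> 0 < word_weight p P (take n w).
Proof.
move=> p0 P0; case: n => [|n]; first by rewrite take0 ltr01.
case: w => [|i w]; first by [].
rewrite [take _ _]/= -{1}(cat_take_drop n w) word_weight_cat => h.
rewrite lt0r word_weight_ge0// andbT; apply/eqP => h0.
by move: h; rewrite h0 mul0r ltxx.
Qed.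

Lemma path_exists P : path_closed P -> forall i j,
  exists2 s, 0 < path_weight P i s & last i s = j.
Proof.
move=> pP i j; apply: (pP [set i | exists2 s, 0 < path_weight P i s & last i s = j]).
  by exists j; exists [::].
by move=> h k [s s0 sk] Phk; exists (k :: s) => //=; rewrite mulr_gt0.
Qed.

Lemma word_exists p P i : path_closed P ->
  (exists j, 0 < p 0 j) -> exists s, 0 < word_weight p P (rcons s i).
Proof.
move=> pP [j pj]; have [s s0 si] := path_exists pP j i.
case/lastP: s s0 si => [|s k] s0 /=; first by move=> <-; exists [::]; rewrite /= mulr1.
by rewrite last_rcons => <-; exists (j :: s); rewrite /= mulr_gt0.
Qed.

Lemma big_tuple_rcons n (F : seq 'I_l -> R) :
  \sum_(w : n.+1.-tuple 'I_l) F w = \sum_(w : n.-tuple 'I_l) \sum_j F (rcons w j).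
Proof.
pose h (wj : n.-tuple 'I_l * 'I_l) := [tuple of rcons wj.1 wj.2].
rewrite pair_big/= (reindex h)//=; apply/onW_bij/inj_card_bij.
  move=> [w j] [w' j'] /(congr1 val)/= /rcons_inj[ww' ->].
  by congr (_, _); apply: val_inj.
by rewrite card_prod !card_tuple expnSr card_ord.
Qed.

Lemma big_tuple0 (F : seq 'I_l -> R) : \sum_(w : 0.-tuple 'I_l) F w = F [::].
Proof.
rewrite (bigD1 [tuple])//= big1 ?addr0// => w /eqP[]; exact: tuple0.
Qed.

Lemma word_weight_sum_rcons p P w : is_prob_vec (p 0) -> stochastic P ->
  \sum_j word_weight p P (rcons w j) = word_weight p P w.
Proof.
move=> [_ p1] sP; case/lastP: w => [|w i].
  by rewrite /= -[RHS]p1; apply: eq_bigr => j _; rewrite mulr1.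
under eq_bigr do rewrite word_weight_rcons.
by rewrite -mulr_sumr (sP i).2 mulr1.
Qed.

(** Letters past the prefix are summed out with total weight 1. This consistency lets word weights
    act as a measure where none has been constructed. *)
Lemma word_weight_sum_prefix p P (f : seq 'I_l -> R) n N :
  is_prob_vec (p 0) -> stochastic P -> (n <= N)%N ->
  \sum_(w : N.-tuple 'I_l) word_weight p P w * f (take n w) =
  \sum_(w : n.-tuple 'I_l) word_weight p P w * f w.
Proof.
move=> hp sP /subnK<-; elim: (N - n)%N => [|k IH].
  by apply: eq_bigr => w _; rewrite take_oversize ?size_tuple.
rewrite addSn (big_tuple_rcons _ (fun w => word_weight p P w * f (take n w))) -IH.
apply: eq_bigr => w _.
under eq_bigr => j _ do rewrite -cats1 takel_cat ?size_tuple ?leq_addl// cats1.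
by rewrite -mulr_suml word_weight_sum_rcons.
Qed.

Lemma word_weight_sum1 p P n : is_prob_vec (p 0) -> stochastic P ->
  \sum_(w : n.-tuple 'I_l) word_weight p P w = 1.
Proof.
move=> hp sP; have := word_weight_sum_prefix (fun=> 1) hp sP (leq0n n).
under eq_bigr do rewrite mulr1; move->.
by rewrite (big_tuple0 (fun w => word_weight p P w * 1)) mulr1.
Qed.

(** The left side is the product [p P ^ n u], evaluated from its last letter. [i0] is the default of
    [last] on the empty word, which does not occur in length [n.+1]. *)
Lemma word_weight_sum_eigen p P (u : 'I_l -> R) (r : R) i0 n :
  (forall i, \sum_j P i j * u j = r * u i) ->
  \sum_(w : n.+1.-tuple 'I_l) word_weight p P w * u (last i0 w) =
  r ^+ n * \sum_i p 0 i * u i.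
Proof.
move=> Pu; elim: n => [|n IH].
  rewrite (big_tuple_rcons _ (fun w => word_weight p P w * u (last i0 w))).
  rewrite (big_tuple0 (fun w => \sum_j word_weight p P (rcons w j) * u (last i0 (rcons w j)))).
  by rewrite expr0 mul1r; apply: eq_bigr => i _; rewrite /= mulr1.
rewrite (big_tuple_rcons _ (fun w => word_weight p P w * u (last i0 w))).
rewrite exprS -mulrA -IH mulr_sumr; apply: eq_bigr => w _.
case/lastP: (tval w) (size_tuple w) => [//|s i _].
under eq_bigr do rewrite word_weight_rcons last_rcons -mulrA.
by rewrite -mulr_sumr Pu last_rcons mulrCA.
Qed.

Lemma path_weight_sqrt P Q i s :
  (forall i j, 0 <= P i j) -> (forall i j, 0 <= Q i j) ->
  path_weight (\matrix_(i, j) Num.sqrt (P i j * Q i j)) i s =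
  Num.sqrt (path_weight P i s * path_weight Q i s).
Proof.
move=> P0 Q0; elim: s i => [|j s IH] i /=; first by rewrite mulr1 sqrtr1.
by rewrite IH mxE -sqrtrM ?mulr_ge0// mulrACA.
Qed.

Lemma word_weight_sqrt p P Q w : (forall i, 0 <= p 0 i) ->
  (forall i j, 0 <= P i j) -> (forall i j, 0 <= Q i j) ->
  word_weight p (\matrix_(i, j) Num.sqrt (P i j * Q i j)) w =
  Num.sqrt (word_weight p P w * word_weight p Q w).
Proof.
move=> p0 P0 Q0; case: w => [|i s] /=; first by rewrite mulr1 sqrtr1.
by rewrite path_weight_sqrt// mulrACA -expr2 [in RHS]sqrtrM ?sqr_ge0// sqrtr_sqr ger0_norm.
Qed.

(* The weight of an allowed path telescopes: it depends only on its length and its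
   endpoints. *)
Definition gibbs_mx (t : R) (g : 'I_l -> R) P : Prop :=
  forall i j, P i j = 0 \/ P i j = t * g j / g i.

Lemma path_weight_gibbs (t : R) (g : 'I_l -> R) P i s : 0 < t ->
  (forall i, 0 < g i) -> gibbs_mx t g P ->
  path_weight P i s = 0 \/ path_weight P i s = t ^+ size s * g (last i s) / g i.
Proof.
move=> t0 g0 gP; elim: s i => [|j s IH] i /=.
  by right; rewrite expr0 mul1r divff// gt_eqF.
case: (gP i j) => ->; first by left; rewrite mul0r.
case: (IH j) => ->; first by left; rewrite mulr0.
by right; rewrite exprS; field; rewrite !gt_eqF.
Qed.

(** Apart from the power of [t], a nonzero weight depends only on the first and last letters, and
    there are finitely many such pairs. *)
Lemma word_weight_gibbs (t : R) (g : 'I_l -> R) p P : 0 < t ->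
  is_prob_vec (p 0) -> (forall i, 0 < g i) -> gibbs_mx t g P ->
  exists C, exists2 c, 0 < c & 0 < C /\ forall w,
    word_weight p P w = 0 \/ c * t ^+ size w <= word_weight p P w <= C * t ^+ size w.
Proof.
move=> t0 [p0 p1] g0 gP.
pose F (ij : 'I_l * 'I_l) := if p 0 ij.1 == 0 then 1 else p 0 ij.1 * g ij.2 / (g ij.1 * t).
have F0 ij : 0 < F ij.
  rewrite /F; case: eqP => // /eqP pi; rewrite divr_gt0 ?mulr_gt0//.
  by rewrite lt0r pi p0.
have [c c0 cF] := finite_lbound F0.
have [d d0 dF] := finite_lbound (fun ij => etrans (invr_gt0 (F ij)) (F0 ij)).
(* Comparing with 1 accommodates the empty word, of weight 1. *)
exists (Num.max 1 d^-1); exists (Num.min 1 c); first by rewrite lt_min ltr01.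
split=> [|w]; first by rewrite lt_max ltr01.
case: w => [|i s].
  by right; rewrite /= expr0 !mulr1 ge_min le_max lexx.
rewrite /=; have [pi|pi] := eqVneq (p 0 i) 0; first by left; rewrite pi mul0r.
have [->|->] := path_weight_gibbs i s t0 g0 gP; first by left; rewrite mulr0.
right; have -> : p 0 i * (t ^+ size s * g (last i s) / g i) =
    F (i, last i s) * t ^+ (size s).+1.
  by rewrite /F/= (negbTE pi) exprS; field; rewrite !gt_eqF.
rewrite !ler_pM2r ?exprn_gt0// ge_min cF orbT/= le_max; apply/orP; right.
by rewrite -(invrK (F _)) lef_pV2 ?posrE ?invr_gt0.
Qed.

End Words.

(** * Cylinders *)

Section Cylinders.
Variables (R : realType) (l : nat).
Hypothesis hl : (2 <= l)%N.
Implicit Types (s : seq 'I_l) (e : nat -> 'I_l) (x : R).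
Local Notation cyl w := (@cylinder R l _ w).

Let l0 : (0 < l)%N. Proof. exact: ltnW hl. Qed.
Let lR0 : 0 < l%:R :> R. Proof. by rewrite ltr0n. Qed.
Let lRN0 : l%:R != 0 :> R. Proof. by rewrite gt_eqF. Qed.
Let lX0 n : 0 < l%:R ^+ n :> R. Proof. by rewrite exprn_gt0. Qed.
Let lXN0 n : l%:R ^+ n != 0 :> R. Proof. by rewrite gt_eqF. Qed.

Let rightE k n : k%:R / l%:R ^+ n + l%:R ^- n = k.+1%:R / l%:R ^+ n :> R.
Proof. by rewrite -natr1 mulrDl mul1r. Qed.

(** The integer with base [l] digits [s]. Cylinders of generation [n] become unit intervals with
    integer left endpoints after scaling by [l ^ n]. *)
Definition word_index s : nat := foldl (fun a (i : 'I_l) => (a * l + i)%N) 0%N s.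

Lemma word_index_rcons s i : word_index (rcons s i) = (word_index s * l + i)%N.
Proof. by rewrite /word_index foldl_rcons. Qed.

Lemma word_index_lt s : (word_index s < l ^ size s)%N.
Proof.
elim/last_ind: s => [|s i IH]; first by rewrite expn0.
rewrite word_index_rcons size_rcons expnSr.
apply: (@leq_trans ((word_index s).+1 * l)%N); last by rewrite leq_mul2r IH orbT.
by rewrite mulSn addnC ltn_add2r.
Qed.

Lemma word_index_inj s s' : size s = size s' -> word_index s = word_index s' -> s = s'.
Proof.
elim/last_ind: s s' => [|s i IH]; case/lastP => [|s' i'] //; rewrite ?size_rcons//.
move=> [ss']; rewrite !word_index_rcons => E.
have ii' : i = i'.
  by apply: val_inj; have := congr1 (modn^~ l) E; rewrite /= !modnMDl !modn_small.
congr rcons => //; apply: IH => //.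
by move: E; rewrite ii' => /addIn/eqP; rewrite eqn_pmul2r// => /eqP.
Qed.

Lemma cylinder_leftE n (w : n.-tuple 'I_l) :
  cylinder_left R w = (word_index w)%:R / l%:R ^+ n.
Proof.
pose i0 := Ordinal l0.
have H s : \sum_(i < size s) (nth i0 s i)%:R / l%:R ^+ i.+1 =
    (word_index s)%:R / l%:R ^+ size s :> R.
  elim/last_ind: s => [|s j IH]; first by rewrite big_ord0 mul0r.
  rewrite size_rcons big_ord_recr/= nth_rcons ltnn eqxx.
  under eq_bigr do rewrite nth_rcons ltn_ord.
  by rewrite IH word_index_rcons natrD natrM exprS; field; rewrite lRN0 lXN0.
case: w => s sn; have /eqP E := sn; subst n; rewrite /cylinder_left/= -H.
by apply: eq_bigr => i _; rewrite (tnth_nth i0).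
Qed.

Lemma cylinderP n (w : n.-tuple 'I_l) x :
  cyl w x <-> (word_index w)%:R <= x * l%:R ^+ n < (word_index w).+1%:R.
Proof.
rewrite /cylinder /= in_itv/= cylinder_leftE rightE.
by rewrite ler_pdivrMr// ltr_pdivlMr.
Qed.

Lemma closure_itvco (a b : R) : a < b -> closure `[a, b[%classic = `[a, b]%classic.
Proof.
move=> ab; apply/seteqP; split.
  rewrite [X in _ `<=` X](iffLR (closure_id _)); last exact: itv_closed.
  by apply: closure_subset => y /=; rewrite !in_itv/= => /andP[-> /ltW].
move=> y /=; rewrite in_itv/= => /andP[ay]; rewrite le_eqVlt => /predU1P[->|yb]; last first.
  by apply: subset_closure; rewrite /= in_itv/= ay.
move=> B /nbhs_ballP[e /= e0 eB]; exists (Num.max a (b - e / 2)); split.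
  rewrite /= in_itv/= le_max lexx/= gt_max ab/= ltrBlDr ltrDl divr_gt0//.
apply: eB; rewrite /ball/= ger0_norm.
  rewrite ltrBlDr -ltrBlDl lt_max; apply/orP; right; lra.
by rewrite subr_ge0 ge_max (ltW ab) lerBlDr lerDl divr_ge0// ltW.
Qed.

Lemma closure_cylinderP n (w : n.-tuple 'I_l) x : closure (cyl w) x <->
  (word_index w)%:R <= x * l%:R ^+ n <= (word_index w).+1%:R.
Proof.
rewrite closure_itvco; last by rewrite ltrDl invr_gt0.
rewrite /= in_itv/= cylinder_leftE rightE.
by rewrite ler_pdivrMr// ler_pdivlMr.
Qed.

Lemma closure_cylinder_dist n (w : n.-tuple 'I_l) x y :
  closure (cyl w) x -> closure (cyl w) y -> `|x - y| <= l%:R ^- n.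
Proof.
move=> /closure_cylinderP/andP[a1 a2] /closure_cylinderP/andP[b1 b2].
rewrite -(ler_pM2r (lX0 n)) mulVf// -[X in _ * X](gtr0_norm (lX0 n)) -normrM.
rewrite ler_norml mulrBl; move: a1 a2 b1 b2; rewrite -natr1.
by move: (word_index _)%:R (x * _) (y * _) => *; lra.
Qed.

(** The inequalities are strict because neighbouring closed cylinders share an endpoint. *)
Lemma closure_cylinder_inj n (w w' : n.-tuple 'I_l) x :
  (word_index w)%:R < x * l%:R ^+ n < (word_index w).+1%:R ->
  closure (cyl w') x -> w' = w.
Proof.
move=> /andP[h1 h2] /closure_cylinderP/andP[h3 h4].
apply/val_inj/word_index_inj; first by rewrite !size_tuple.
have := lt_le_trans h1 h4; have := le_lt_trans h3 h2.
by rewrite !ltr_nat !ltnS => a b; apply/eqP; rewrite eqn_leq a b.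
Qed.

Lemma cylinder_inj n (w w' : n.-tuple 'I_l) x :
  cyl w x -> cyl w' x -> w = w'.
Proof.
move=> /cylinderP/andP[h1 h2] /cylinderP/andP[h3 h4].
apply/val_inj/word_index_inj; first by rewrite !size_tuple.
have := le_lt_trans h1 h4; have := le_lt_trans h3 h2.
by rewrite !ltr_nat !ltnS => a b; apply/eqP; rewrite eqn_leq a b.
Qed.

Lemma cylinder_itv01 n (w : n.-tuple 'I_l) x : cyl w x -> 0 <= x < 1.
Proof.
move=> /cylinderP/andP[h1 h2]; apply/andP; split.
  by rewrite -(pmulr_lge0 _ (lX0 n)) (le_trans _ h1).
rewrite -(ltr_pM2r (lX0 n)) mul1r (lt_le_trans h2)// -natrX ler_nat.
by have := word_index_lt w; rewrite size_tuple.
Qed.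

(** The word is the one whose index is the integer part of [x * l ^ n]; it exists because
    [word_index], injective between finite sets of equal size, is onto. *)
Lemma cylinder_exists n x : 0 <= x < 1 -> exists w : n.-tuple 'I_l, cyl w x.
Proof.
move=> /andP[x0 x1].
have X0 : 0 <= x * l%:R ^+ n by rewrite mulr_ge0// ltW.
have /andP[t1 t2] := truncn_itv X0.
have tl : (Num.truncn (x * l%:R ^+ n) < l ^ n)%N.
  rewrite -(ltr_nat R) natrX (le_lt_trans t1)// -[ltRHS]mul1r ltr_pM2r//.
pose h (w : n.-tuple 'I_l) : 'I_(l ^ n) :=
  Ordinal (eq_ind (size w) (fun k => (word_index w < l ^ k)%N) (word_index_lt w) _ (size_tuple w)).
have hinj : injective h.
  move=> w w' /(congr1 val)/= E; apply/val_inj/word_index_inj => //.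
  by rewrite !size_tuple.
have [g _ gK] : bijective h by apply: inj_card_bij => //; rewrite card_ord card_tuple card_ord.
exists (g (Ordinal tl)); apply/cylinderP.
by have /(congr1 val)/= -> := gK (Ordinal tl); rewrite t1 t2.
Qed.

Lemma adic_intervalE n (w : n.-tuple 'I_l) x :
  cyl w x -> adic_interval l n x = cyl w.
Proof.
move=> wx; rewrite /adic_interval.
have [|[w' _ <-] w'x] := @xgetPex _ set0 [set J : set R | adic_intervals l n J /\ J x].
  by exists (cyl w); split => //; exists w.
by rewrite (cylinder_inj w'x wx).
Qed.

Lemma lebesgue_cylinder n (w : n.-tuple 'I_l) :
  lebesgue_measure (cyl w) = (l%:R ^- n)%:E :> \bar R.
Proof.
rewrite /cylinder lebesgue_measure_itv/= lte_fin ltrDl invr_gt0 lX0.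
by rewrite -EFinB addrAC subrr add0r.
Qed.

Lemma measurable_cylinder n (w : n.-tuple 'I_l) :
  measurable (cyl w : set (measurableTypeR R)).
Proof. exact: measurable_itv. Qed.

Definition prefix_tuple e n : n.-tuple 'I_l := Tuple (introT eqP (size_mkseq e n)).

(** The point with digit expansion [e]: left endpoints of the nested cylinders increase to it. It
    may equal 1. *)
Definition infinite_word_point e : R :=
  sup (range (fun n => (word_index (mkseq e n))%:R / l%:R ^+ n : R)).

Let lft e n : R := (word_index (mkseq e n))%:R / l%:R ^+ n.

Let lftS e n : lft e n.+1 = lft e n + (e n)%:R / l%:R ^+ n.+1.
Proof.
by rewrite /lft mkseqS word_index_rcons natrD natrM exprS; field; rewrite lRN0 lXN0.
Qed.

Let lft_mono e n m : (n <= m)%N -> lft e n <= lft e m.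
Proof.
move=> /subnK<-; elim: (m - n)%N => // k IH; rewrite addSn (le_trans IH)// lftS lerDl.
by rewrite divr_ge0// ltW.
Qed.

(** Right endpoints decrease along the nested cylinders, strictly unless the new digit is [l - 1];
    this is the origin of the conditions [e k < l.-1] below. *)
Let rgtS e n : lft e n.+1 + l%:R ^- n.+1 <= lft e n + l%:R ^- n ?= iff (val (e n) == l.-1).
Proof.
rewrite lftS -addrA -[in X in _ + (_ + X)](mul1r (l%:R ^- n.+1)) -mulrDl natr1.
have -> : l%:R ^- n = l%:R / l%:R ^+ n.+1 :> R.
  by rewrite exprS invfM mulrA divff// mul1r.
split; first by rewrite lerD2l ler_pM2r ?invr_gt0// ler_nat.
rewrite (inj_eq (addrI _)) (inj_eq (mulIf _)) ?invr_eq0// eqr_nat.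
by rewrite -[X in _ == X](prednK l0) eqSS.
Qed.

Let rgt_mono e n m : (n <= m)%N -> lft e m + l%:R ^- m <= lft e n + l%:R ^- n.
Proof.
by move=> /subnK<-; elim: (m - n)%N => // k IH; rewrite addSn (le_trans _ IH)// rgtS.
Qed.

Let lft_le_rgt e n m : lft e m <= lft e n + l%:R ^- n.
Proof.
have h k : lft e k <= lft e k + l%:R ^- k by rewrite lerDl invr_ge0 ltW.
case: (leqP n m) => nm; first exact: le_trans (h m) (rgt_mono e nm).
exact: le_trans (lft_mono e (ltnW nm)) (h n).
Qed.

Let lft_pt e n : lft e n <= infinite_word_point e.
Proof.
apply: ub_le_sup; last by exists n.
by exists (lft e 0 + l%:R ^- 0) => _ [m _ <-]; exact: lft_le_rgt.
Qed.

Let pt_rgt e n : infinite_word_point e <= lft e n + l%:R ^- n.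
Proof.
by apply: ge_sup => [|_ [m _ <-]]; [exists (lft e 0), 0%N|exact: lft_le_rgt].
Qed.

Lemma infinite_word_point_closure e n :
  closure (cyl (prefix_tuple e n)) (infinite_word_point e).
Proof.
apply/closure_cylinderP/andP; split; first by rewrite -ler_pdivrMr// lft_pt.
by rewrite -ler_pdivlMr// -rightE pt_rgt.
Qed.

Lemma infinite_word_point_gt e n k : (n <= k)%N -> (0 < e k)%N ->
  (word_index (mkseq e n))%:R < infinite_word_point e * l%:R ^+ n.
Proof.
move=> nk ek; rewrite -ltr_pdivrMr//; apply: (le_lt_trans (lft_mono e nk)).
apply: lt_le_trans (lft_pt e k.+1); rewrite lftS ltrDl divr_gt0// ltr0n//.
Qed.

Lemma infinite_word_point_lt e n k : (n <= k)%N -> (e k < l.-1)%N ->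
  infinite_word_point e * l%:R ^+ n < (word_index (mkseq e n)).+1%:R.
Proof.
move=> nk ek; rewrite -ltr_pdivlMr// -rightE.
apply: lt_le_trans (rgt_mono e nk); apply: le_lt_trans (pt_rgt e k.+1) _.
by rewrite (lt_leif (rgtS e k)) ltn_eqF.
Qed.

(** Each generation needs a later digit below [l - 1], since otherwise the point is the excluded
    right endpoint. *)
Lemma infinite_word_point_cylinder e n :
  (forall n, exists2 k, (n <= k)%N & (e k < l.-1)%N) ->
  cyl (prefix_tuple e n) (infinite_word_point e).
Proof.
move=> he; apply/cylinderP; have [k nk ek] := he n.
by rewrite (infinite_word_point_lt nk ek) -ler_pdivrMr// lft_pt.
Qed.

End Cylinders.

(** * Transitions read off the support *)

Section InfiniteWords.
Variables (R : realType) (l : nat).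
Implicit Types (p : 'rV[R]_l) (P : 'M[R]_l) (s : seq 'I_l) (e : nat -> 'I_l).

Lemma word_weight_mkseqS p P e n :
  word_weight p P (mkseq e n.+2) = word_weight p P (mkseq e n.+1) * P (e n) (e n.+1).
Proof. by rewrite !mkseqS word_weight_rcons. Qed.

Lemma infinite_word p P s i :
  (forall i, 0 <= p 0 i) -> (forall i j, 0 <= P i j) ->
  (forall i, exists j, 0 < P i j) -> 0 < word_weight p P (rcons s i) ->
  exists e, mkseq e (size s).+1 = rcons s i /\
    forall n, 0 < word_weight p P (mkseq e n).
Proof.
move=> p0 P0 /choice[nx nxP] s0.
(* Past the given word the default of [nth] takes over: [k - size s] steps of [nx] from the last
   letter [i]. *)
pose e k := nth (iter (k.+1 - size (rcons s i)) nx i) (rcons s i) k.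
have eE k : (k <= size s)%N -> e k = nth i (rcons s i) k.
  by move=> ks; apply: set_nth_default; rewrite size_rcons ltnS.
have es : mkseq e (size s).+1 = rcons s i.
  apply: (@eq_from_nth _ i) => [|k]; rewrite size_mkseq ?size_rcons// ltnS => ks.
  by rewrite nth_mkseq ?ltnS// eE.
exists e; split=> // n; case: (leqP n (size s).+1) => ns.
  have -> : mkseq e n = take n (mkseq e (size s).+1).
    by rewrite /mkseq -map_take take_iota (minn_idPl ns).
  by rewrite es; exact: word_weight_take_gt0.
have eI k : (size s <= k)%N -> e k = iter (k - size s) nx i.
  rewrite leq_eqVlt => /predU1P[<-|sk].
    by rewrite subnn eE// nth_rcons ltnn eqxx.
  by rewrite /e size_rcons subSS nth_default ?size_rcons.
case: n ns => [//|n]; rewrite ltnS => /ltnW/subnKC <-.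
elim: (n - size s)%N => [|k IH]; first by rewrite addn0 es.
rewrite addnS word_weight_mkseqS mulr_gt0// !eI ?leqW ?leq_addr//.
by rewrite subSn ?leq_addr.
Qed.

(* Irreducibility lets the extension use both digits 0 and l - 1 after the given word,
   which keeps its point away from the endpoints of the cylinder. *)
Lemma interior_infinite_word (hl : (2 <= l)%N) p P s i :
  (forall i, 0 <= p 0 i) -> (forall i j, 0 <= P i j) -> path_closed P ->
  0 < word_weight p P (rcons s i) ->
  exists e, [/\ mkseq e (size s).+1 = rcons s i,
    forall n, 0 < word_weight p P (mkseq e n) &
    (word_index (rcons s i))%:R < infinite_word_point R e * l%:R ^+ (size s).+1
      < (word_index (rcons s i)).+1%:R].
Proof.
move=> p0 P0 pP s0; have l0 : (0 < l)%N := ltnW hl.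
have lm : (l.-1 < l)%N by rewrite prednK.
pose a := Ordinal l0; pose b := Ordinal lm.
have lb : (0 < l.-1)%N by rewrite -ltnS prednK.
have rowP h : exists j, 0 < P h j := path_closed_row h hl pP.
have [k Pik] := rowP i.
have [u u0 ua] := path_exists pP k a.
have [v v0 vb] := path_exists pP a b.
have t0 : 0 < word_weight p P (rcons s i ++ k :: u ++ v).
  by rewrite word_weight_rcons_cat /= path_weight_cat ua !mulr_gt0.
(* [v] is nonempty because the digits [a] and [b] differ. Its last letter [b] is a nonzero digit
   after the given word, which moves the point off the left endpoint. *)
case/lastP: v v0 vb t0 => [_ /(congr1 val)/= E|v c v0]; first by rewrite -E in lb.
rewrite last_rcons => -> t0.
have tE : rcons s i ++ k :: u ++ rcons v b = rcons (rcons s i ++ k :: u ++ v) b.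
  by rewrite !(rcons_cat, rcons_cons).
rewrite tE in t0.
have [e [et e0]] := infinite_word p0 P0 rowP t0.
pose t := rcons s i ++ k :: u ++ rcons v b.
have szt : size t = (size (rcons s i ++ k :: u ++ v)).+1 by rewrite /t tE size_rcons.
have en n : (n < size t)%N -> e n = nth a t n.
  by move=> nt; rewrite /t tE -et nth_mkseq// -szt.
have es : mkseq e (size s).+1 = rcons s i.
  apply: (@eq_from_nth _ a) => [|n]; rewrite size_mkseq ?size_rcons// => ns.
  rewrite nth_mkseq// en; first by rewrite /t nth_cat size_rcons ns.
  by rewrite /t size_cat size_rcons ltn_addr.
exists e; split => //; rewrite -es.
apply/andP; split.
  apply: (@infinite_word_point_gt _ _ hl _ _ (size t).-1).
    by rewrite szt/= size_cat size_rcons leq_addr.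
  rewrite en; last by rewrite szt.
  by rewrite nth_last /t tE last_rcons.
(* This is the position of the last letter of [k :: u], the digit 0, which is below [l - 1]. *)
apply: (@infinite_word_point_lt _ _ hl _ _ ((size s).+1 + size u)).
  exact: leq_addr.
rewrite en.
  suff -> : nth a t ((size s).+1 + size u) = a by [].
  rewrite /t nth_cat size_rcons ltnNge leq_addr/= addKn -cat_cons nth_cat/= ltnS leqnn.
  by have := nth_last a (k :: u) => /= ->; rewrite ua.
by rewrite /t size_cat size_rcons ltn_add2l/= ltnS size_cat leq_addr.
Qed.

End InfiniteWords.

Lemma word_weight01 (R : realType) (l : nat) (p0 : 'rV[R]_l) (P0 : 'M[R]_l) (w : seq 'I_l) :
  (forall i, p0 0 i = 0 \/ p0 0 i = 1) -> (forall i j, P0 i j = 0 \/ P0 i j = 1) ->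
  word_weight p0 P0 w = 0 \/ word_weight p0 P0 w = 1.
Proof.
move=> h01 H01; have H i s : path_weight P0 i s = 0 \/ path_weight P0 i s = 1.
  elim: s i => [|j s IH] i /=; first by right.
  by case: (H01 i j) => ->; rewrite ?mul0r ?mul1r//; left.
case: w => [|i s] /=; first by right.
by case: (h01 i) => ->; rewrite ?mul0r ?mul1r//; left.
Qed.

Lemma word_weight01_gt0 (R : realType) (l : nat) (p0 : 'rV[R]_l) (P0 : 'M[R]_l) (w : seq 'I_l) :
  (forall i, p0 0 i = 0 \/ p0 0 i = 1) -> (forall i j, P0 i j = 0 \/ P0 i j = 1) ->
  0 < word_weight p0 P0 w <-> word_weight p0 P0 w = 1.
Proof.
move=> h H; have [->|->] := word_weight01 w h H; split=> //; first by rewrite ltxx.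
by move/eqP; rewrite eq_sym oner_eq0.
Qed.

Lemma markov_compactP (R : realType) (l : nat) (p0 : 'rV[R]_l) (P0 : 'M[R]_l) (x : R) :
  markov_compact p0 P0 x <-> forall n, (0 < n)%N ->
    exists w : n.-tuple 'I_l, word_weight p0 P0 w = 1 /\ closure (cylinder w) x.
Proof.
split=> [Kx n n0|Kx n /= n0]; first by have [w ww xw] := Kx n n0; exists w.
by have [w [ww xw]] := Kx n n0; exists w.
Qed.

Lemma exprVn_small (R : realType) (l : nat) (e : R) : (2 <= l)%N -> 0 < e ->
  exists n, l%:R ^- n < e.
Proof.
move=> hl e0.
exists (Num.truncn e^-1).+1; rewrite invf_plt ?posrE ?exprn_gt0 ?ltr0n ?(ltnW hl)//.
apply: lt_le_trans (truncnS_gt _) _; rewrite -natrX ler_nat ltnW//.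
exact: ltn_expl.
Qed.

Section Support.
Variables (R : realType) (l : nat) (hl : (2 <= l)%N).
Variables (P0 : 'M[R]_l) (p0 : 'rV[R]_l) (P : 'M[R]_l) (p : 'rV[R]_l).
Hypotheses (hP0 : forall i j, P0 i j = 0 \/ P0 i j = 1)
  (hp0 : forall i, p0 0 i = 0 \/ p0 0 i = 1) (pP0 : path_closed P0).
Hypotheses (hp : is_prob_vec (p 0)) (hP : stochastic P) (pP : path_closed P).
Variable m : probability (measurableTypeR R) R.
Hypotheses (hm : markov_driven p P m)
  (hsupp : measure_support m = markov_compact p0 P0).

Let P00 i j : 0 <= P0 i j. Proof. by case: (hP0 i j) => ->. Qed.
Let p00 i : 0 <= p0 0 i. Proof. by case: (hp0 i) => ->. Qed.
Let Pge0 i j : 0 <= P i j. Proof. exact: (hP i).1. Qed.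
Let pge0 i : 0 <= p 0 i. Proof. exact: hp.1. Qed.

Lemma measure_cylinder n (w : n.-tuple 'I_l) : m (cylinder w) = (word_weight p P w)%:E.
Proof.
case: n w => [w|n w]; last exact: hm.2.
rewrite (tuple0 w)/= -hm.1; congr (m _).
by rewrite /cylinder /cylinder_left big_ord0 add0r expr0 invr1.
Qed.

(** Both directions test a point interior to the cylinder. If it is in the support, the open
    cylinder has positive mass; if it is in [K], the closed cylinder of an allowed word containing
    it can only be this one. *)
Lemma support_word s i :
  word_weight p0 P0 (rcons s i) = 1 <-> 0 < word_weight p P (rcons s i).
Proof.
pose n := (size s).+1; pose w : n.-tuple 'I_l := rcons_tuple (in_tuple s) i.
split=> [w0|w0].
  have w0' : 0 < word_weight p0 P0 (rcons s i) by rewrite w0.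
  have [e [es e0 ei]] := interior_infinite_word hl p00 P00 pP0 w0'.
  have : measure_support m (infinite_word_point R e).
    rewrite hsupp; apply/markov_compactP => k k0; exists (prefix_tuple e k).
    split; last exact: infinite_word_point_closure.
    by apply: (iffLR (word_weight01_gt0 _ hp0 hP0)); exact: e0.
  pose U := [set x : R | (word_index (rcons s i))%:R / l%:R ^+ n < x
                          < (word_index (rcons s i)).+1%:R / l%:R ^+ n].
  have lX : 0 < l%:R ^+ n :> R by rewrite exprn_gt0// ltr0n ltnW.
  have Uo : open U.
    have -> : U = `](word_index (rcons s i))%:R / l%:R ^+ n,
        (word_index (rcons s i)).+1%:R / l%:R ^+ n[%classic.
      by apply/seteqP; split => x; rewrite /U /= in_itv.
    exact: interval_open.
  move=> /(_ U Uo) mU; have {}mU : (0 < m U)%E.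
    by apply: mU; rewrite /U /= ltr_pdivrMr// ltr_pdivlMr.
  rewrite -lte_fin -[X in (_ < X)%E](measure_cylinder w); apply: lt_le_trans mU _.
  apply: le_measure; rewrite ?inE; [exact: open_measurable|exact: measurable_cylinder|].
  move=> x; rewrite /U/= ltr_pdivrMr// ltr_pdivlMr// => /andP[h1 h2].
  by apply/cylinderP => //; rewrite h2 ltW.
have [e [es e0 ei]] := interior_infinite_word hl pge0 Pge0 pP w0.
have : markov_compact p0 P0 (infinite_word_point R e).
  rewrite -hsupp => U Uo Ux.
  have /nbhs_ballP[r /= r0 rU] : nbhs (infinite_word_point R e) U by exact: open_nbhs_nbhs.
  have [k kr] := exprVn_small hl r0.
  apply: lt_le_trans (_ : (0 < m (cylinder (prefix_tuple e k)))%E) _.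
    by rewrite measure_cylinder lte_fin; exact: e0.
  apply: le_measure; rewrite ?inE; [exact: measurable_cylinder|exact: open_measurable|].
  move=> y yc; apply: rU; apply: le_lt_trans kr.
  apply: (closure_cylinder_dist hl _ (subset_closure yc)).
  exact: infinite_word_point_closure.
move=> /markov_compactP/(_ n isT)[w' [w'1 w'x]].
have -> : rcons s i = w' by rewrite (closure_cylinder_inj hl (w := w) _ w'x).
exact: w'1.
Qed.

Hypothesis hp0nz : p0 <> 0.

Let p0ex : exists i, 0 < p0 0 i.
Proof.
apply: contrapT => /forallNP h; apply: hp0nz; apply/rowP => i; rewrite mxE.
by case: (hp0 i) => // E; case: (h i); rewrite E.
Qed.

Let pex : exists i, 0 < p 0 i.
Proof.
apply: contrapT => /forallNP h; have := hp.2; rewrite big1 => [/eqP|i _].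
  by rewrite eq_sym oner_eq0.
by apply/eqP; rewrite eq_le pge0 andbT leNgt; apply/negP/h.
Qed.

(** By irreducibility some word of positive weight ends at [i]; appending [j] reduces the claim to
    [support_word]. *)
Lemma support_transition i j : 0 < P0 i j <-> 0 < P i j.
Proof.
split=> [Pij|Pij].
  have [s s0] := word_exists i pP0 p0ex.
  have : 0 < word_weight p0 P0 (rcons (rcons s i) j) by rewrite word_weight_rcons mulr_gt0.
  move/(word_weight01_gt0 _ hp0 hP0)/support_word; rewrite word_weight_rcons => h.
  rewrite lt0r Pge0 andbT; apply/eqP => E; by rewrite E mulr0 ltxx in h.
have [s s0] := word_exists i pP pex.
have : 0 < word_weight p P (rcons (rcons s i) j) by rewrite word_weight_rcons mulr_gt0.
move/support_word/(word_weight01_gt0 _ hp0 hP0); rewrite word_weight_rcons => h.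
rewrite lt0r P00 andbT; apply/eqP => E; by rewrite E mulr0 ltxx in h.
Qed.

End Support.

(** * Bounds on the Hausdorff dimension *)

Section HausdorffBounds.
Variable R : realType.
Implicit Types (E U : set R) (s t d r : R).

Lemma diameter_le U r : (forall x y, U x -> U y -> `|x - y| <= r) ->
  (diameter U <= r%:E)%E.
Proof.
move=> Ur; apply: ge_ereal_sup => _ [[x y] [/= Ux Uy] <-].
by rewrite lee_fin Ur.
Qed.

Lemma diameter_ge U x y : U x -> U y -> (`|x - y|%:E <= diameter U)%E.
Proof. by move=> Ux Uy; apply: ereal_sup_ubound; exists (x, y). Qed.

Lemma hausdorff_gauge_ge0 s U : (0 <= hausdorff_gauge s U)%E.
Proof. by rewrite /hausdorff_gauge; case: ifP => // _; rewrite poweR_ge0. Qed.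

Lemma hausdorff_gauge_le s U r : 0 <= s -> 0 <= r ->
  (forall x y, U x -> U y -> `|x - y| <= r) -> (hausdorff_gauge s U <= (r `^ s)%:E)%E.
Proof.
move=> s0 r0 Ur; rewrite /hausdorff_gauge; case: ifPn => [_|/set0P[x Ux]].
  by rewrite lee_fin powR_ge0.
have d0 : (0 <= diameter U)%E.
  by apply: le_trans (diameter_ge Ux Ux); rewrite lee_fin.
rewrite -poweR_EFin; apply: gt0_ler_poweR => //; rewrite ?in_itv/= ?leey ?andbT//.
exact: diameter_le.
Qed.

Lemma hausdorff_premeasure_ge0 s d E : (0 <= hausdorff_premeasure s d E)%E.
Proof.
apply: le_ereal_inf_tmp => _ [V _ <-]; apply: nneseries_ge0 => k _ _.
exact: hausdorff_gauge_ge0.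
Qed.

(** Natural numbers that code no index receive the empty set, whose gauge is 0. This allows covers
    indexed by words. *)
Lemma hausdorff_premeasure_esum (I : countType) s d E (V : I -> set R) :
  0 <= d -> E `<=` \bigcup_i V i -> (forall i, diameter (V i) <= d%:E)%E ->
  (hausdorff_premeasure s d E <= \esum_(i in [set: I]) hausdorff_gauge s (V i))%E.
Proof.
move=> d0 EV dV.
pose U (k : nat) : set R := if pickle_inv k is Some i then V i else set0.
have UV i : U (pickle i) = V i by rewrite /U pickleK_inv.
have -> : (\esum_(i in [set: I]) hausdorff_gauge s (V i) =
    \sum_(0 <= k <oo) hausdorff_gauge s (U k))%E.
  rewrite nneseries_esumT; last by move=> k; exact: hausdorff_gauge_ge0.
  under eq_esum do rewrite -UV.
  rewrite -(esum_image setT pickle (fun k => hausdorff_gauge s (U k))); last first.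
    by move=> i j _ _ /(pcan_inj pickleK).
  rewrite esum_mkcond; apply: eq_esum => k _; case: ifPn => // /negP kP.
  rewrite /U; have := @pickle_invK I k; case: pickle_inv => [i /= ik|].
    by case: kP; rewrite inE; exists i.
  by rewrite /hausdorff_gauge eqxx.
apply: ereal_inf_lbound; exists U => //; split.
  by move=> x /EV[i _ Vx]; exists (pickle i) => //; rewrite UV.
move=> k; rewrite /U; case: pickle_inv => // .
by rewrite /diameter setX0 image_set0 ereal_sup0 leNye.
Qed.

Lemma geometric_tail_le (rho : R) N K : 0 <= rho < 1 ->
  \sum_(0 <= n < K) (if (N <= n)%N then rho ^+ n else 0) <= rho ^+ N / (1 - rho).
Proof.
move=> /andP[r0 r1]; rewrite ler_pdivlMr ?subr_gt0//.
case: (leqP K N) => KN.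
  rewrite big_nat big1 ?mul0r ?exprn_ge0// => n /andP[_ nK].
  by rewrite leqNgt (leq_trans nK).
rewrite (big_cat_nat (leq0n N) (ltnW KN))//= big_nat big1 ?add0r => [|n /andP[_ nN]]; last first.
  by rewrite leqNgt nN.
rewrite big_nat_cond (eq_bigr (fun n => rho ^+ n)) => [|n /andP[/andP[-> _] _]//].
rewrite -big_nat_cond -[X in bigop.body _ (index_iota X _)](add0n N) big_addn.
under eq_bigr do rewrite exprD mulrC.
rewrite -mulr_sumr -mulrA ler_piMr ?exprn_ge0//.
rewrite big_mkord mulrC -opprB mulNr -subrX1 opprB.
by rewrite gerBl exprn_ge0.
Qed.

Lemma hausdorff_dim_le s E : 0 <= s ->
  (forall t, s < t -> hausdorff_measure t E = 0%E) -> (hausdorff_dim E <= s%:E)%E.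
Proof.
move=> s0 H; apply/lee_addgt0Pr => e e0; rewrite -EFinD.
apply: ereal_inf_lbound; exists (s + e) => //; split; first by rewrite addr_ge0 // ltW.
by apply: H; rewrite ltrDl.
Qed.

Lemma hausdorff_measure_eq0 s E :
  (forall d e : R, 0 < d -> 0 < e -> (hausdorff_premeasure s d E <= e%:E)%E) ->
  hausdorff_measure s E = 0%E.
Proof.
move=> H; apply/eqP; rewrite eq_le; apply/andP; split; last first.
  apply: le_trans (hausdorff_premeasure_ge0 s 1 E) _.
  by apply: ereal_sup_ubound; exists 1 => //=.
apply: ge_ereal_sup => _ [d /= d0 <-]; apply/lee_addgt0Pr => e e0.
by rewrite add0e H.
Qed.

End HausdorffBounds.

Lemma exprn_small (R : realType) (r e : R) : 0 <= r < 1 -> 0 < e ->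
  exists N, forall n, (N <= n)%N -> r ^+ n < e.
Proof.
move=> /andP[r0 r1] e0; have /cvgr0Pnorm_lt/(_ e e0)[N _ NP] : GRing.exp r @ \oo --> 0.
  by apply: cvg_expr; rewrite ger0_norm.
exists N => n Nn; have := NP n Nn; exact/le_lt_trans/ler_norm.
Qed.

Lemma esum_words (R : realType) (l : nat) (f : seq 'I_l -> R) : (forall w, 0 <= f w) ->
  (\esum_(w in [set: seq 'I_l]) (f w)%:E =
   \sum_(0 <= n <oo) (\sum_(w : n.-tuple 'I_l) f w)%:E)%E.
Proof.
move=> f0; pose F n := [set w : seq 'I_l | size w = n].
have -> : [set: seq 'I_l] = \bigcup_n F n.
  by apply/seteqP; split => // w _; exists (size w).
rewrite nneseries_sum_bigcup; last 2 first.
- by move=> i j _ _ [w [/= <- <-]].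
- by move=> w; rewrite lee_fin.
apply: eq_eseriesr => n _.
rewrite (reindex_esum [set: n.-tuple 'I_l] (F n) val); last first.
  split; first by move=> w _; exact: size_tuple.
    by move=> w w' _ _; exact: val_inj.
  by move=> w /= wn; exists (tcast wn (in_tuple w)) => //; rewrite val_tcast.
rewrite esum_fset//; [|exact: finite_finset|by move=> w _; rewrite lee_fin].
rewrite (fsbigE (index_enum (n.-tuple 'I_l)))//; last 2 first.
- exact: index_enum_uniq.
- by move=> w _; rewrite mem_index_enum.
by rewrite -sumEFin; apply: eq_bigl => w; apply: mem_set.
Qed.

(** * Dimension bounds from cylinders *)

Section AdicBounds.
Variables (R : realType) (l : nat).
Hypothesis hl : (2 <= l)%N.
Implicit Types (E U : set R) (s t d r : R).

(** This is [l ^ (- s)]: its [n]-th power is the [s]-gauge of a cylinder of generation [n]. *)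
Definition adic_scale s : R := (l%:R^-1) `^ s.

Let l0 : 0 < l%:R :> R. Proof. by rewrite ltr0n (ltnW hl). Qed.
Let li0 : 0 < l%:R^-1 :> R. Proof. by rewrite invr_gt0. Qed.
Let li1 : l%:R^-1 < 1 :> R. Proof. by rewrite invf_lt1// ltr1n. Qed.

Lemma adic_scale_gt0 s : 0 < adic_scale s.
Proof. exact: powR_gt0. Qed.

Lemma adic_scale_lt1 s : 0 < s -> adic_scale s < 1.
Proof.
move=> s0; rewrite /adic_scale /powR gt_eqF// expR_lt1 pmulr_rlt0//.
by rewrite ln_lt0// li0.
Qed.

Lemma adic_scaleD s t : adic_scale (s + t) = adic_scale s * adic_scale t.
Proof. by rewrite /adic_scale powRD// (gt_eqF li0) implybT. Qed.

Lemma adic_scaleX s n : (l%:R ^- n) `^ s = adic_scale s ^+ n.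
Proof.
elim: n => [|n IH]; first by rewrite !expr0 invr1 powR1.
by rewrite exprS invfM powRM ?invr_ge0 ?exprn_ge0 ?ltW// IH exprS.
Qed.

Lemma adic_exprV_le n m : (n <= m)%N -> l%:R ^- m <= l%:R ^- n :> R.
Proof.
move=> nm; rewrite lef_pV2 ?posrE ?exprn_gt0//.
by rewrite ler_weXn2l// ler1n ltnW.
Qed.

(** Total weight at most 1 leaves at most [l ^ (n s) / c] heavy words of length [n]. For [t > s]
    their [t]-gauges sum to at most a constant times [l ^ (- n (t - s))], so the heavy cylinders of
    generation at least [N] form a cover of arbitrarily small cost. *)
Lemma hausdorff_dim_le_heavy (q : seq 'I_l -> R) s c E : (forall w, 0 <= q w) ->
  (forall n, \sum_(w : n.-tuple 'I_l) q w <= 1) -> 0 <= s -> 0 < c ->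
  (forall x, E x -> forall N, exists2 n, (N <= n)%N &
     exists w : n.-tuple 'I_l, closure (cylinder w) x /\ c * adic_scale s ^+ n <= q w) ->
  (hausdorff_dim E <= s%:E)%E.
Proof.
move=> q0 q1 s0 c0 HE; apply: hausdorff_dim_le => // t st.
have t0 : 0 <= t by rewrite (le_trans s0)// ltW.
apply: hausdorff_measure_eq0 => d e d0 e0.
pose rho := adic_scale (t - s).
have r0 : 0 < rho by exact: adic_scale_gt0.
have r1 : rho < 1 by rewrite adic_scale_lt1// subr_gt0.
have r01 : 0 <= rho < 1 by rewrite r1 ltW.
have [N1 N1d] := exprVn_small hl d0.
have e'0 : 0 < e * (1 - rho) * c by rewrite !mulr_gt0// subr_gt0.
have [N2 N2e] := exprn_small r01 e'0.
pose N := maxn N1 N2.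
pose V (w : seq 'I_l) : set R :=
  if (N <= size w)%N && (c * adic_scale s ^+ size w <= q w)
  then closure (cylinder (in_tuple w)) else set0.
apply: (@le_trans _ _ (\esum_(w in [set: seq 'I_l]) hausdorff_gauge t (V w))%E).
  apply: hausdorff_premeasure_esum; first exact: ltW.
    move=> x Ex; have [n Nn [w [wx wq]]] := HE x Ex N.
    exists (tval w) => //.
    have -> : V w = closure (cylinder (in_tuple w)) by rewrite /V ifT// size_tuple Nn.
    apply/(closure_cylinderP hl); rewrite /= size_tuple.
    exact: (iffLR (closure_cylinderP hl _ _) wx).
  move=> w; apply: diameter_le => x y; rewrite /V; case: ifP => // /andP[Nw _] xw yw.
  apply: (le_trans (closure_cylinder_dist hl xw yw)).
  apply/ltW/(le_lt_trans _ N1d)/adic_exprV_le.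
  exact: leq_trans (leq_maxl _ _) Nw.
pose k n := if (N <= n)%N then rho ^+ n else 0.
have k0 n : 0 <= k n by rewrite /k; case: ifP => // _; rewrite exprn_ge0// ltW.
apply: (@le_trans _ _ (\esum_(w in [set: seq 'I_l]) (c^-1 * k (size w) * q w)%:E)%E).
  apply: le_esum => w _; rewrite /V /k.
  case: ifPn => [/andP[Nw wq]|_]; last first.
    rewrite /hausdorff_gauge eqxx lee_fin mulr_ge0// mulr_ge0 ?invr_ge0 ?(ltW c0)//.
    exact: k0.
  apply: (le_trans (hausdorff_gauge_le t0 _ (closure_cylinder_dist hl (w := in_tuple w)))).
    by rewrite invr_ge0 exprn_ge0// ltW.
  rewrite lee_fin adic_scaleX Nw -(subrK s t) adic_scaleD -/rho exprMn.
  by rewrite [c^-1 * _]mulrC -mulrA ler_pM2l ?exprn_gt0// ler_pdivlMl.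
rewrite (esum_words (f := fun w => c^-1 * k (size w) * q w)); last first.
  by move=> w; rewrite !mulr_ge0// invr_ge0 ltW.
apply: lime_le.
  apply: is_cvg_nneseries => n _ _; rewrite lee_fin sumr_ge0// => w _.
  by rewrite !mulr_ge0// invr_ge0 ltW.
apply: nearW => K; rewrite sumEFin lee_fin.
apply: (@le_trans _ _ (\sum_(0 <= n < K) c^-1 * k n)).
  apply: ler_sum => n _; under eq_bigr do rewrite size_tuple.
  by rewrite -mulr_sumr ler_piMr// mulr_ge0// invr_ge0 ltW.
rewrite -mulr_sumr ler_pdivrMl//; apply: (le_trans (geometric_tail_le N K r01)).
rewrite ler_pdivrMr ?subr_gt0// ltW// (lt_le_trans (N2e N _)) ?leq_maxr//.
by rewrite mulrC mulrA.
Qed.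

(* Mass distribution principle, with the mass of a ball already bounded by a power of its
   radius. *)
Lemma hausdorff_dim_ge s c E : 0 <= s -> 0 < c ->
  (forall (x : nat -> R) (n : nat -> nat), E `<=` \bigcup_k ball (x k) (l%:R ^- n k) ->
    (c%:E <= \sum_(0 <= k <oo) (adic_scale s ^+ n k)%:E)%E) ->
  (s%:E <= hausdorff_dim E)%E.
Proof.
move=> s0 c0 HE; apply: le_ereal_inf_tmp => _ [t [t0 Ht] <-].
rewrite lee_fin leNgt; apply/negP => ts.
have s0' : 0 < s by exact: le_lt_trans ts.
have b0 := adic_scale_gt0 s; have b1 := adic_scale_lt1 s0'.
have b01 : 0 <= adic_scale s < 1 by rewrite b1 ltW.
(* [L = l ^ s] is the loss in rounding a diameter up to a power of [l]. The constant [eta] is chosen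
   so that [(L + 1) eta < c], the second [eta] paying for the errors below. *)
pose L := (adic_scale s)^-1; have L0 : 0 < L by rewrite invr_gt0.
pose eta := c / (L + 2).
have eta0 : 0 < eta by rewrite divr_gt0// addr_gt0.
have : (hausdorff_premeasure t l%:R^-1 E < eta%:E)%E.
  apply: (@le_lt_trans _ _ 0%E); last by rewrite lte_fin.
  by rewrite -Ht; apply: ereal_sup_ubound; exists l%:R^-1.
move=> /ereal_inf_lt[_ [U [EU dU] <-] sU].
have H k : exists xn : R * nat, U k `<=` ball xn.1 (l%:R ^- xn.2) /\
    ((adic_scale s ^+ xn.2)%:E <= L%:E * hausdorff_gauge t (U k) + (eta / (2 ^ k.+1)%:R)%:E)%E.
  have ek0 : 0 < eta / (2 ^ k.+1)%:R by rewrite divr_gt0// ltr0n expn_gt0.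
  have Lg0 : (0 <= L%:E * hausdorff_gauge t (U k))%E.
    by rewrite mule_ge0 ?hausdorff_gauge_ge0// lee_fin ltW.
  (* Empty and one-point sets may have gauge 0 while every ball costs something; the summable errors
     [eta / 2 ^ k.+1] pay for a tiny ball. *)
  have [n0 n0P] := exprn_small b01 ek0.
  have small : ((adic_scale s ^+ n0)%:E <=
      L%:E * hausdorff_gauge t (U k) + (eta / (2 ^ k.+1)%:R)%:E)%E.
    apply: (@le_trans _ _ (eta / (2 ^ k.+1)%:R)%:E); last by rewrite leeDr.
    by rewrite lee_fin ltW// n0P.
  have [Uk|/set0P[x0 Ux0]] := eqVneq (U k) set0.
    by exists (0, n0); split => //; rewrite Uk.
  have dist x : U k x -> (`|x0 - x|%:E <= diameter (U k))%E.
    by move=> Ux; exact: diameter_ge.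
  case E1 : (diameter (U k)) (dU k) dist => [D| |] //; last first.
    by move=> _ /(_ _ Ux0).
  rewrite lee_fin => Dl dist.
  have D0 : 0 <= D by have := dist _ Ux0; rewrite lee_fin; apply: le_trans.
  have [DE|DN0] := eqVneq D 0.
    exists (x0, n0); split => //= x Ux; rewrite /ball/=.
    have := dist _ Ux; rewrite lee_fin DE => /le_lt_trans; apply.
    by rewrite invr_gt0 exprn_gt0.
  have Dp : 0 < D by rewrite lt0r DN0.
  (* Minimality gives [l ^- n.+1 <= D < l ^- n]. The bound [D <= l ^- 1] excludes generation 0 and
     gives [D ^ s <= D ^ t] for [t < s]. *)
  have ex : exists n, l%:R ^- n <= D by have [n /ltW nD] := exprVn_small hl Dp; exists n.
  case: (ex_minnP ex) => -[|n] nD nmin.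
    by move: nD; rewrite expr0 invr1 leNgt (le_lt_trans Dl).
  exists (x0, n); split => /=.
    move=> x Ux; rewrite /ball/=; have := dist _ Ux; rewrite lee_fin => /le_lt_trans; apply.
    by rewrite ltNge; apply/negP => /nmin; rewrite ltnn.
  apply: (@le_trans _ _ (L%:E * hausdorff_gauge t (U k))%E); last first.
    by rewrite leeDl// lee_fin ltW.
  rewrite /hausdorff_gauge ifF; last by apply/negP => /eqP Uk; rewrite Uk in Ux0.
  rewrite E1 poweR_EFin -EFinM lee_fin ler_pdivlMl// -exprS -adic_scaleX.
  apply: (@le_trans _ _ (D `^ s)).
    by apply: ge0_ler_powR => //; rewrite nnegrE ?invr_ge0 ?exprn_ge0// ltW.
  by apply: ger_powR; rewrite ?Dp ?(le_trans Dl)// ltW.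
have [xn xnP] := choice H.
have := HE (fst \o xn) (snd \o xn) => /(_ _)/wrap[].
  by move=> x /EU[k _ Ux]; exists k => //=; apply: (xnP k).1.
apply/negP; rewrite -ltNge.
apply: (@le_lt_trans _ _ (\sum_(0 <= k <oo)
    (L%:E * hausdorff_gauge t (U k) + (eta / (2 ^ k.+1)%:R)%:E))%E).
  apply: lee_nneseries => k _; last exact: (xnP k).2.
  by rewrite lee_fin exprn_ge0// ltW.
apply: le_lt_trans (epsilon_trick _ _ (ltW eta0)) _.
  by move=> k; rewrite mule_ge0 ?hausdorff_gauge_ge0// lee_fin ltW.
rewrite nneseriesZl; last by move=> k _; exact: hausdorff_gauge_ge0.
apply: (@le_lt_trans _ _ (L%:E * eta%:E + eta%:E)%E).
  by rewrite leeD2r// lee_pmul2l// ltW.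
rewrite -EFinM -EFinD lte_fin -[X in _ + X]mul1r -mulrDl /eta mulrC -mulrA gtr_pMr//.
by rewrite ltr_pdivrMl ?addr_gt0// mulr1 ltrD2l ltr1n.
Qed.

End AdicBounds.

(** * Dimension of the Markov compact set *)

Section Near.
Variables (R : realType) (l : nat).
Hypothesis hl : (2 <= l)%N.
Implicit Types (x y : R).

Let lX0 n : 0 < l%:R ^+ n :> R. Proof. by rewrite exprn_gt0// ltr0n ltnW. Qed.

(** The closed cylinder of [w] meets the ball of radius [l ^- n] about [x]. The length of [w] is
    independent of [n], so that prefixes can be taken. *)
Definition near_word (n : nat) x (w : seq 'I_l) : bool :=
  `[< exists2 y, (word_index w)%:R <= y * l%:R ^+ size w <= (word_index w).+1%:R &
      ball x (l%:R ^- n) y >].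

Lemma near_word_take n x (w : seq 'I_l) k : near_word n x w -> near_word n x (take k w).
Proof.
have H (s : seq 'I_l) i : near_word n x (rcons s i) -> near_word n x s.
  move=> /asboolP[y yw yx]; apply/asboolP; exists y => //.
  have l0 : 0 < l%:R :> R by rewrite ltr0n ltnW.
  move: yw; rewrite word_index_rcons size_rcons exprSr mulrA => /andP[h1 h2].
  apply/andP; split; rewrite -(ler_pM2r l0) -natrM.
    by apply: le_trans h1; rewrite ler_nat leq_addr.
  by apply: (le_trans h2); rewrite ler_nat mulSn -addnS addnC leq_add2r ltn_ord.
elim/last_ind: w => [//|w i IH] wi; case: (leqP k (size w)) => kw.
  by rewrite -cats1 takel_cat//; apply: IH; apply: H wi.
by rewrite take_oversize// size_rcons.
Qed.

Lemma near_word_cylinder n x y (w : n.-tuple 'I_l) :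
  closure (cylinder w) y -> ball x (l%:R ^- n) y -> near_word n x w.
Proof.
move=> wy xy; apply/asboolP; exists y => //; rewrite size_tuple.
exact/(closure_cylinderP hl).
Qed.

(** After scaling by [l ^ n] the ball has radius 1, so two such indices differ by at most 2; five
    values are thus possible around a fixed word [w0]. *)
Lemma card_near_word n x : (#|[set w : n.-tuple 'I_l | near_word n x w]%SET| <= 5)%N.
Proof.
set S := finset _.
have [->|[w0 w0S]] := set_0Vmem S; first by rewrite cards0.
have H w : w \in S -> exists2 y, (word_index w)%:R <= y * l%:R ^+ n <= (word_index w).+1%:R &
    `|x * l%:R ^+ n - y * l%:R ^+ n| < 1.
  rewrite inE => /asboolP[y]; rewrite size_tuple => yw yx; exists y => //.
  by rewrite -mulrBl normrM (gtr0_norm (lX0 n)) -ltr_pdivlMr// mul1r.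
have D w : w \in S -> (word_index w < word_index w0 + 3)%N /\ (word_index w0 < word_index w + 3)%N.
  move=> wS; have [y yw xy] := H w wS; have [z zw xz] := H w0 w0S.
  rewrite -!(ltr_nat R) !natrD; move: yw xy zw xz; rewrite -!natr1 !ltr_norml.
  move: (word_index w)%:R (word_index w0)%:R (x * _) (y * _) (z * _) => a b X Y Z.
  by move=> /andP[? ?] /andP[? ?] /andP[? ?] /andP[? ?]; split; lra.
pose h (w : n.-tuple 'I_l) : 'I_5 := inord (word_index w + 2 - word_index w0).
rewrite -[X in (_ <= X)%N](card_ord 5) -(card_in_imset (f := h)) ?max_card//.
have hE w : w \in S -> (h w = word_index w + 2 - word_index w0 :> nat)%N.
  by move=> /D[]; rewrite /h; move: (word_index w) (word_index w0) => a b *; rewrite inordK//; lia.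
move=> w w' wS w'S /(congr1 (@nat_of_ord 5)); rewrite !hE// => E.
apply/val_inj/(word_index_inj hl); first by rewrite !size_tuple.
move: E (D w wS) (D w' w'S).
by move: (word_index w) (word_index w') (word_index w0) => a a' b ? [? ?] [? ?]; lia.
Qed.

Lemma sum_near_word_le (q : seq 'I_l -> R) (M : R) n x : 0 <= M ->
  (forall w : n.-tuple 'I_l, q w <= M) ->
  \sum_(w : n.-tuple 'I_l | near_word n x w) q w <= 5 * M.
Proof.
move=> M0 qM; apply: (@le_trans _ _ (\sum_(w : n.-tuple 'I_l | near_word n x w) M)).
  exact: ler_sum.
rewrite sumr_const -(mulr_natl M) ler_wpM2r// ler_nat.
by have := card_near_word n x; rewrite cardsE.
Qed.

End Near.

Lemma markov_compact_compact (R : realType) (l : nat) (p0 : 'rV[R]_l) (P0 : 'M[R]_l) :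
  (2 <= l)%N -> compact (markov_compact p0 P0).
Proof.
move=> hl; apply: (@subclosed_compact R _ `[0, 1]%classic).
- apply: closed_bigI => n _; apply: closed_bigcup => [|w _]; last exact: closed_closure.
  exact: finite_finset.
- exact: segment_compact.
move=> x /markov_compactP/(_ 1%N isT)[w [_ /(closure_cylinderP hl)/andP[h1 h2]]].
have l0 : 0 < l%:R :> R by rewrite ltr0n ltnW.
rewrite /= in_itv/=; rewrite expr1 in h1 h2; apply/andP; split.
  by rewrite -(pmulr_lge0 _ l0) (le_trans _ h1).
rewrite -(ler_pM2r l0) mul1r (le_trans h2)// ler_nat.
by have := word_index_lt w; rewrite size_tuple expn1.
Qed.

Section DimCompact.
Variables (R : realType) (l : nat) (hl : (2 <= l)%N).
Variables (P0 : 'M[R]_l) (p0 : 'rV[R]_l) (Q : 'M[R]_l) (p : 'rV[R]_l).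
Variables (s : R) (g : 'I_l -> R).
Hypotheses (s0 : 0 <= s) (g0 : forall i, 0 < g i) (hp : is_prob_vec (p 0))
  (hQ : stochastic Q) (gQ : gibbs_mx (adic_scale l s) g Q)
  (pQ : forall w, word_weight p0 P0 w = 1 <-> 0 < word_weight p Q w).

Let p00 i : 0 <= p 0 i. Proof. exact: hp.1. Qed.
Let Q0 i j : 0 <= Q i j. Proof. exact: (hQ i).1. Qed.

Lemma compact_meets_cylinder n (w : n.+1.-tuple 'I_l) : 0 < word_weight p Q w ->
  exists2 y, markov_compact p0 P0 y & closure (cylinder w) y.
Proof.
move=> w0; have [t [i E]] : exists t, exists i, tval w = rcons t i.
  by case/lastP: (tval w) (size_tuple w) => [//|t i _]; exists t, i.
have rowQ i' : exists j, 0 < Q i' j.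
  apply: contrapT => /forallNP h; have := (hQ i').2; rewrite big1 => [/eqP|j _].
    by rewrite eq_sym oner_eq0.
  by apply/eqP; rewrite eq_le Q0 andbT leNgt; apply/negP/h.
rewrite E in w0; have [e [et e0]] := infinite_word p00 Q0 rowQ w0.
exists (infinite_word_point R e).
  apply/markov_compactP => k k0; exists (prefix_tuple e k); split.
    by apply/pQ; exact: e0.
  exact: infinite_word_point_closure.
have -> : w = prefix_tuple e n.+1.
  apply: val_inj; rewrite /= E -et; congr mkseq.
  by have := congr1 size E; rewrite size_tuple size_rcons.
exact: infinite_word_point_closure.
Qed.

Lemma hausdorff_dim_markov_compact : hausdorff_dim (markov_compact p0 P0) = s%:E.
Proof.
have b0 := adic_scale_gt0 hl s.
have [C [c c0 [C0 Cw]]] := word_weight_gibbs b0 hp g0 gQ.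
apply/eqP; rewrite eq_le; apply/andP; split.
  apply: (@hausdorff_dim_le_heavy _ _ hl (word_weight p Q) s c) => //.
  - by move=> w; rewrite word_weight_ge0.
  - by move=> n; rewrite word_weight_sum1.
  move=> x /markov_compactP Kx N; exists N.+1 => //.
  have [w [w1 wx]] := Kx N.+1 isT; exists w; split => //.
  move/pQ: w1 => w1; case: (Cw w) => [wE|/andP[]]; first by rewrite wE ltxx in w1.
  by rewrite size_tuple.
apply: (@hausdorff_dim_ge _ _ hl s (5 * C)^-1) => //; first by rewrite invr_gt0 mulr_gt0.
move=> x n Kcov; set q := word_weight p Q.
have cK := @markov_compact_compact R l p0 P0 hl; rewrite compact_cover in cK.
have [//|D' _ Kcov'] := cK nat setT (fun k => ball (x k) (l%:R ^- n k)) _ Kcov.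
  by move=> k _; apply: ball_open; rewrite invr_gt0 exprn_gt0// ltr0n ltnW.
(* One generation at least as fine as all the finitely many balls, and positive. Every allowed word
   of length [N] has a point of [K] in its closed cylinder, hence in some ball [k], and then its
   prefix of length [n k] is near that ball. *)
pose N := (\max_(k <- D') n k).+1.
have nN k : k \in D' -> (n k <= N)%N.
  by move=> kD; apply: leqW; exact: leq_bigmax_seq.
have q0 w : 0 <= q w by rewrite word_weight_ge0.
have main : 1 <= \sum_(k <- D') 5 * (C * adic_scale l s ^+ n k).
  rewrite -[leLHS](word_weight_sum1 N hp hQ).
  apply: (@le_trans _ _ (\sum_(w : N.-tuple 'I_l) \sum_(k <- D') q w * (near_word (n k) (x k) (take (n k) w))%:R)).
    apply: ler_sum => w _; have [qw|qw] := eqVneq (q w) 0.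
      by rewrite -/q qw sumr_ge0// => k _; rewrite mul0r.
    have qw0 : 0 < word_weight p Q w by rewrite lt0r qw q0.
    have [y Ky wy] := compact_meets_cylinder qw0.
    have [k kD xy] := Kcov' y Ky.
    rewrite (big_rem k)//= ler_wpDr ?sumr_ge0// => [j _|]; first by rewrite mulr_ge0.
    rewrite near_word_take ?mulr1//; apply/asboolP; exists y => //.
    rewrite size_tuple; exact/(closure_cylinderP hl).
  rewrite exchange_big/=; rewrite big_seq [leRHS]big_seq; apply: ler_sum => k kD.
  rewrite (word_weight_sum_prefix (fun v => (near_word (n k) (x k) v)%:R) hp hQ (nN k kD)).
  apply: (@le_trans _ _ (\sum_(w : (n k).-tuple 'I_l | near_word (n k) (x k) w) q w)).
    rewrite [leRHS]big_mkcond/=; apply: ler_sum => w _.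
    by case: near_word; rewrite ?mulr1// mulr0.
  apply: sum_near_word_le => //; first by rewrite mulr_ge0 ?exprn_ge0// ltW.
  move=> w; case: (Cw w) => [qw|/andP[_]]; last by rewrite size_tuple.
  by rewrite /q qw mulr_ge0 ?exprn_ge0// ltW.
apply: (@le_trans _ _ (\sum_(k <- D') (adic_scale l s ^+ n k)%:E)%E).
  rewrite sumEFin lee_fin -[_^-1]mul1r ler_pdivrMr ?mulr_gt0//.
  apply: (le_trans main); rewrite mulr_suml; apply: ler_sum => k _.
  by rewrite mulrA mulrC.
by apply: (@lee_sum_fset_lim _ _ _ xpredT) => k _; rewrite lee_fin exprn_ge0// ltW.
Qed.

End DimCompact.

(** * Dimension of the Markov measure *)

Section MeasureDim.
Variables (R : realType) (l : nat) (hl : (2 <= l)%N).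
Variables (P : 'M[R]_l) (p : 'rV[R]_l).
Hypotheses (hp : is_prob_vec (p 0)) (hP : stochastic P).
Variable m : probability (measurableTypeR R) R.
Hypothesis hm : markov_driven p P m.

Let p00 i : 0 <= p 0 i. Proof. exact: hp.1. Qed.
Let Pge0 i j : 0 <= P i j. Proof. exact: (hP i).1. Qed.
Let q := word_weight p P.
Let q0 w : 0 <= q w. Proof. exact: word_weight_ge0. Qed.

Lemma measurable_cylinders n (S : pred (n.-tuple 'I_l)) :
  measurable (\bigcup_(w in [set w | S w]) cylinder w : set (measurableTypeR R)).
Proof.
by apply: fin_bigcup_measurable => [|w _]; [exact: finite_finset|exact: measurable_cylinder].
Qed.

Lemma measure_cylinders n (S : pred (n.-tuple 'I_l)) :
  m (\bigcup_(w in [set w | S w]) cylinder w) = (\sum_(w | S w) q w)%:E.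
Proof.
rewrite measure_fin_bigcup; last 3 first.
- exact: finite_finset.
- by move=> w w' _ _ [x [wx w'x]]; exact: (cylinder_inj hl wx w'x).
- by move=> w _; exact: measurable_cylinder.
rewrite (fsbigE (enum S)); last 3 first.
- exact: enum_uniq.
- by move=> w /=; rewrite mem_enum.
- by move=> w /= Sw; rewrite mem_enum -topredE/= Sw.
rewrite big_enum_cond -sumEFin; apply: eq_big => [w|w _].
  by rewrite -topredE/=; case Sw : (S w) => //=; exact: mem_set.
exact: (measure_cylinder hm w).
Qed.

Lemma measure_itv01 (E : set (measurableTypeR R)) : measurable E ->
  m E = m (E `&` `[0, 1[%classic).
Proof.
move=> mE; have mI : measurable (`[0, 1[%classic : set (measurableTypeR R)) by exact: measurable_itv.
rewrite (measureDI _ mE mI) [X in (X + _)%E](_ : _ = 0%E) ?add0e//.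
apply/eqP; rewrite eq_le measure_ge0 andbT.
have : m (~` `[0%R, 1%R[%classic) = 0%E.
  by rewrite probability_setC// hm.1 subee.
move=> h; apply: (@le_trans _ _ (m (~` `[0, 1[%classic))); last by rewrite h.
have mIC := measurableC mI.
by apply: le_measure; [apply/mem_set/measurableD|exact: mem_set mIC|move=> x []].
Qed.

(** Here [m] itself is the mass: a ball of radius [l ^- n] meets at most five cylinders of
    generation [n], each of mass at most [C * l ^ (- n s)]. *)
Lemma lower_dim_ge s g : 0 <= s -> (forall i, 0 < g i) -> gibbs_mx (adic_scale l s) g P ->
  (s%:E <= lower_dim m)%E.
Proof.
move=> s0 g0 gP; apply: le_ereal_inf_tmp => _ [E [mE E0] <-].
have b0 := adic_scale_gt0 hl s.
have [C [c c0 [C0 Cw]]] := word_weight_gibbs b0 hp g0 gP.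
have mEfin : m E \is a fin_num by exact: fin_num_measure.
have E0' : 0 < fine (m E) by rewrite -lte_fin fineK.
apply: (@hausdorff_dim_ge _ _ hl s (fine (m E) / (5 * C))) => //.
  by rewrite divr_gt0// mulr_gt0.
move=> x n Ecov.
pose B k := \bigcup_(w in [set w : (n k).-tuple 'I_l | near_word (n k) (x k) w]) (cylinder w : set R).
have : (m (E `&` `[0%R, 1%R[%classic) <= \sum_(0 <= k <oo) m (B k))%E.
  apply: measure_sigma_subadditive.
  - by move=> k; exact: measurable_cylinders.
  - by apply: measurableI => //; exact: measurable_itv.
  - move=> y [/Ecov[k _ yk]]; rewrite /= in_itv/= => y01; exists k => //.
    have [w wy] := cylinder_exists hl (n k) y01; exists w => //=.
    by apply: (near_word_cylinder hl (subset_closure wy)).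
rewrite -measure_itv01// => mEB.
rewrite mulrC EFinM fineK// -lee_pdivlMl ?invr_gt0 ?mulr_gt0// invrK.
rewrite -nneseriesZl; last by move=> k _; rewrite lee_fin exprn_ge0// ltW.
apply: (le_trans mEB); apply: lee_nneseries => k _ //; rewrite /B measure_cylinders -EFinM lee_fin.
rewrite -mulrA; apply: sum_near_word_le => //; first by rewrite mulr_ge0 ?exprn_ge0// ltW.
move=> w; case: (Cw w) => [qw|/andP[_]]; last by rewrite size_tuple.
by rewrite /q qw mulr_ge0 ?exprn_ge0// ltW.
Qed.

Lemma upper_dim_le s c kappa C : 0 <= s -> 0 < c -> 0 <= kappa < 1 ->
  (forall n, \sum_(w : n.+1.-tuple 'I_l | q w < c * adic_scale l s ^+ n.+1) q w
     <= C * kappa ^+ n) ->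
  (upper_dim m <= s%:E)%E.
Proof.
move=> s0 c0 k01 light.
have k0 : 0 <= kappa by case/andP: k01.
pose heavy n (w : n.-tuple 'I_l) := c * adic_scale l s ^+ n <= q w.
pose A n : set (measurableTypeR R) := \bigcup_(w in [set w | @heavy n.+1 w]) cylinder w.
have mA n : measurable (A n) by exact: measurable_cylinders.
pose E := \bigcap_N \bigcup_(n in [set n | (N <= n)%N]) A n.
have mE : measurable E.
  apply: bigcapT_measurable => N; exact: bigcup_measurable.
apply: (@le_trans _ _ (hausdorff_dim E)); last first.
  apply: (@hausdorff_dim_le_heavy _ _ hl q s c) => //.
    by move=> n; rewrite word_weight_sum1.
  move=> x Ex N; have [n /= Nn [w hw wx]] := Ex N I.
  exists n.+1; first exact: leqW.
  by exists w; split => //; exact: subset_closure.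
apply: ereal_inf_lbound; exists E => //; split => //.
suff EC : m (~` E) = 0%E.
  by rewrite -[E]setCK probability_setC ?EC ?sube0//; exact: measurableC.
have lightC n : (m (~` A n) <= (C * kappa ^+ n)%:E)%E.
  rewrite probability_setC// measure_cylinders -EFinB lee_fin.
  rewrite -(word_weight_sum1 n.+1 hp hP) (bigID (@heavy n.+1))/= addrC addrK.
  apply: le_trans (light n); rewrite le_eqVlt; apply/orP; left; apply/eqP.
  by apply: eq_bigl => w; rewrite -ltNge.
have mG N : measurable (\bigcap_(n in [set n | (N <= n)%N]) ~` A n).
  by apply: bigcap_measurable; [exists N => /=|move=> k _; exact: measurableC].
have tail N : m (\bigcap_(n in [set n | (N <= n)%N]) ~` A n) = 0%E.
  apply/eqP; rewrite eq_le measure_ge0 andbT; apply/lee_addgt0Pr => e e0; rewrite add0e.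
  have C1 : 0 < `|C| + 1 by rewrite ltr_wpDl.
  have [M MP] := exprn_small k01 (divr_gt0 e0 C1).
  pose n := maxn M N.
  apply: (@le_trans _ _ (m (~` A n))).
    apply: le_measure; [exact: mem_set (mG N)|exact: mem_set (measurableC (mA n))|].
    by move=> x /(_ n); apply; rewrite /= leq_maxr.
  apply: (le_trans (lightC n)); rewrite lee_fin.
  have /ltW := MP n (leq_maxl _ _); rewrite ler_pdivlMr// => h; apply: le_trans h.
  rewrite mulrC ler_wpM2l ?exprn_ge0//.
  by rewrite (le_trans (ler_norm C))// lerDl.
have -> : ~` E = \bigcup_N \bigcap_(n in [set n | (N <= n)%N]) ~` A n.
  by rewrite setC_bigcap; apply: eq_bigcupr => N _; rewrite setC_bigcup.
apply/eqP; rewrite eq_le measure_ge0 andbT.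
apply: (@le_trans _ _ (\sum_(0 <= N <oo) m (\bigcap_(n in [set n | (N <= n)%N]) ~` A n))%E).
  by apply: measure_sigma_subadditive => //; exact: bigcupT_measurable.
by rewrite eseries0// => N _ _; exact: tail.
Qed.

End MeasureDim.

(** * Exponential decay of the mass of light words *)

Lemma mulr_gt0_inv (R : realType) (a b : R) : 0 <= a -> 0 <= b -> 0 < a * b -> 0 < a /\ 0 < b.
Proof.
move=> a0 b0 ab; split; rewrite lt0r ?a0 ?b0 andbT; apply/eqP => E;
  by rewrite E ?mul0r ?mulr0 ltxx in ab.
Qed.

Lemma word_weight_support (R : realType) (l : nat) (p : 'rV[R]_l) (P Q : 'M[R]_l) w :
  (forall i, 0 <= p 0 i) -> (forall i j, 0 <= P i j) ->
  (forall i j, 0 < P i j -> 0 < Q i j) ->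
  0 < word_weight p P w -> 0 < word_weight p Q w.
Proof.
move=> p0 P0 PQ; have H i s : 0 < path_weight P i s -> 0 < path_weight Q i s.
  elim: s i => [//|j s IH] i /= /mulr_gt0_inv[] //; first exact: path_weight_ge0.
  by move=> Pij Ps; rewrite mulr_gt0 ?IH ?PQ.
case: w => [//|i s] /= /mulr_gt0_inv[] //; first exact: path_weight_ge0.
by move=> pi Ps; rewrite mulr_gt0 ?H.
Qed.

Section EntropyGap.
Variables (R : realType) (l : nat) (hl : (2 <= l)%N).
Variables (P Q : 'M[R]_l) (p : 'rV[R]_l).
Hypotheses (hp : is_prob_vec (p 0)) (hP : stochastic P) (hQ : stochastic Q).
Hypotheses (PQ : forall i j, 0 < P i j <-> 0 < Q i j) (pP : path_closed P).

Let p00 i : 0 <= p 0 i. Proof. exact: hp.1. Qed.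
Let P0 i j : 0 <= P i j. Proof. exact: (hP i).1. Qed.
Let Q0 i j : 0 <= Q i j. Proof. exact: (hQ i).1. Qed.
Let B := \matrix_(i, j) Num.sqrt (P i j * Q i j).

Let B_gap i : 1 - \sum_j B i j = 2^-1 * \sum_j (Num.sqrt (P i j) - Num.sqrt (Q i j)) ^+ 2.
Proof.
have -> : \sum_j (Num.sqrt (P i j) - Num.sqrt (Q i j)) ^+ 2 = \sum_j (P i j + Q i j - 2 * B i j).
  apply: eq_bigr => j _; rewrite sqrrB !sqr_sqrtr// mxE sqrtrM//.
  by rewrite -mulr_natl; ring.
rewrite sumrB big_split/= -mulr_sumr (hP i).2 (hQ i).2.
by field.
Qed.

(* The deficit of the row sums of [B] is half a squared Hellinger distance, so it
   vanishes identically only if [P = Q]. *)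
Lemma bhattacharyya_perron : P <> Q ->
  exists rho (u : 'cV[R]_l), [/\ 0 < rho, rho < 1, forall i, 0 < u i 0 & B *m u = rho *: u].
Proof.
move=> PNQ; have B0 i j : 0 <= B i j by rewrite mxE sqrtr_ge0.
have pB : path_closed B.
  apply: path_closed_support pP => i j Pij; rewrite mxE sqrtr_gt0 mulr_gt0//.
  exact/PQ.
have [rho [u [y [r0 u0 y0 Bu By]]]] := perron hl B0 pB.
exists rho, u; split => //; rewrite ltNge; apply/negP => r1.
have gap0 i : 0 <= 1 - \sum_j B i j.
  by rewrite B_gap mulr_ge0 ?invr_ge0// sumr_ge0// => j _; rewrite sqr_ge0.
(* Pairing the row deficits with the left eigenvector gives [(1 - rho)] times the sum of [y]. If
   [1 <= rho], the nonnegative deficits must all vanish. *)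
have : \sum_i y i 0 * (1 - \sum_j B i j) <= 0.
  under eq_bigr do rewrite mulrBr mulr1.
  rewrite sumrB subr_le0; under [leRHS]eq_bigr do rewrite mulr_sumr.
  rewrite exchange_big/=; apply: ler_sum => j _.
  have -> : \sum_i y i 0 * B i j = rho * y j 0.
    have /matrixP/(_ j 0) := By; rewrite !mxE => <-.
    by apply: eq_bigr => i _; rewrite !mxE mulrC.
  by rewrite ler_peMl// ltW.
move=> le0; have /psumr_eq0P E : \sum_i y i 0 * (1 - \sum_j B i j) = 0.
  by apply/eqP; rewrite eq_le le0 sumr_ge0// => i _; rewrite mulr_ge0// ltW.
apply: PNQ; apply/matrixP => i j.
have /eqP : y i 0 * (1 - \sum_j B i j) = 0.
  by apply: E => // k _; rewrite mulr_ge0// ltW.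
rewrite mulf_eq0 gt_eqF//= B_gap mulf_eq0 invr_eq0 pnatr_eq0/= => /eqP/psumr_eq0P H.
have /eqP := H (fun k _ => sqr_ge0 _) j isT.
rewrite sqrf_eq0 subr_eq0 => /eqP sPQ.
by rewrite -(sqr_sqrtr (P0 i j)) sPQ sqr_sqrtr.
Qed.

(** On a light word of length [n], the weight [q_P] is below [l ^ (- n s')] while
    [q_Q >= c * l ^ (- n s)], so [q_P] is at most [sqrt (q_P q_Q)] times
    [l ^ (n (s - s') / 2) / sqrt c]. The geometric means sum to order [rho ^ n], which wins if
    [s - s'] is small. The factor [1] is the constant [c] of [upper_dim_le]. *)
Lemma light_words s g : 0 < s -> (forall i, 0 < g i) -> gibbs_mx (adic_scale l s) g Q ->
  P <> Q -> exists s' kappa C, [/\ 0 <= s' < s, 0 <= kappa < 1 & forall n,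
    \sum_(w : n.+1.-tuple 'I_l | word_weight p P w < 1 * adic_scale l s' ^+ n.+1)
      word_weight p P w <= C * kappa ^+ n].
Proof.
move=> s0 g0 gQ PNQ; have [rho [u [r0 r1 u0 Bu]]] := bhattacharyya_perron PNQ.
have [e e0 eu] := finite_lbound u0.
have [C [c c0 [_ cw]]] := word_weight_gibbs (adic_scale_gt0 hl s) hp g0 gQ.
have lnl : 0 < ln l%:R :> R by rewrite ln_gt0// ltr1n.
have lnr : ln rho < 0 by rewrite ln_lt0// r0.
(* The first bound keeps [s' = s - 2 delta] nonnegative; the second, halved for strictness, ensures
   [rho < l ^ (- delta)]. *)
pose delta := Num.min (s / 2) (- ln rho / ln l%:R / 2).
have d0 : 0 < delta by rewrite lt_min !divr_gt0//= oppr_gt0.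
have dr : rho < adic_scale l delta.
  have -> : adic_scale l delta = expR (- (delta * ln l%:R)).
    rewrite /adic_scale /powR gt_eqF ?invr_gt0 ?ltr0n ?(ltnW hl)//.
    by rewrite lnV ?posrE ?ltr0n ?(ltnW hl)// mulrN.
  rewrite -[ltLHS]lnK ?posrE// ltr_expR ltrNr.
  apply: (@le_lt_trans _ _ (- ln rho / 2)).
    rewrite -ler_pdivlMr// mulrAC; by rewrite ge_min lexx orbT.
  by move: lnr; lra.
have t0 := adic_scale_gt0 hl delta.
set tau := adic_scale l delta in dr t0.
pose s' := s - (delta + delta).
have s'0 : 0 <= s'.
  have : delta <= s / 2 by rewrite ge_min lexx.
  by rewrite /s'; lra.
have bE n : adic_scale l s ^+ n = adic_scale l s' ^+ n * (tau ^+ n * tau ^+ n).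
  by rewrite -!exprMn -!adic_scaleD// subrK.
pose K := \sum_i p 0 i * u i 0.
exists s', (rho / tau), (K / e / (Num.sqrt c * tau)); split.
- by rewrite s'0/= /s'; move: d0; lra.
- by rewrite ltr_pdivrMr// mul1r dr divr_ge0// ltW.
move=> n; set N := n.+1.
have sc : 0 < Num.sqrt c by rewrite sqrtr_gt0.
have tN : 0 < tau ^+ N by rewrite exprn_gt0.
have i0 : 'I_l by exact: Ordinal (ltnW hl).
apply: (@le_trans _ _ (\sum_(w : N.-tuple 'I_l) word_weight p B w / (Num.sqrt c * tau ^+ N))).
  rewrite [leLHS]big_mkcond/=; apply: ler_sum => w _; rewrite mul1r.
  have wB0 : 0 <= word_weight p B w.
    by rewrite word_weight_ge0// => i j; rewrite mxE sqrtr_ge0.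
  have den0 : 0 <= word_weight p B w / (Num.sqrt c * tau ^+ N).
    by rewrite divr_ge0// mulr_ge0// ltW.
  case: ifPn => // wl.
  have qP0 := word_weight_ge0 w p00 P0.
  have [->//|qPN] := eqVneq (word_weight p P w) 0.
  have qP : 0 < word_weight p P w by rewrite lt0r qPN.
  have qQ : 0 < word_weight p Q w.
    by apply: word_weight_support qP => // i j /PQ.
  have {cw} cw : c * adic_scale l s ^+ N <= word_weight p Q w.
    by case: (cw w) => [E|/andP[]]; [rewrite E ltxx in qQ|rewrite size_tuple].
  rewrite ler_pdivlMr ?mulr_gt0// /B word_weight_sqrt//.
  rewrite -[leLHS]ger0_norm; last by rewrite mulr_ge0// mulr_ge0// ltW.
  rewrite -sqrtr_sqr ler_wsqrtr// !exprMn sqr_sqrtr ?(ltW c0)//.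
  rewrite [X in X * _]expr2 -mulrA ler_wpM2l//.
  apply: le_trans cw; rewrite bE expr2 mulrCA ler_wpM2l ?(ltW c0)//.
  by rewrite ler_wpM2r ?(ltW wl)// mulr_ge0// ltW.
rewrite -mulr_suml /N exprS mulrA invfM.
have -> : K / e / (Num.sqrt c * tau) * (rho / tau) ^+ n =
   (rho ^+ n * K / e) * ((Num.sqrt c * tau)^-1 * (tau ^+ n)^-1).
  by rewrite exprMn exprVn; ring.
rewrite ler_wpM2r//.
  by rewrite mulr_ge0// invr_ge0 ?mulr_ge0 ?exprn_ge0// ltW.
rewrite ler_pdivlMr// -(word_weight_sum_eigen p i0 n (P := B) (u := fun i => u i 0)).
  rewrite mulr_suml; apply: ler_sum => w _; rewrite ler_wpM2l//.
  by rewrite word_weight_ge0// => i j; rewrite mxE sqrtr_ge0.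
by move=> i; have /matrixP/(_ i 0) := Bu; rewrite !mxE.
Qed.

End EntropyGap.

(** * Local dimensions *)

Section LocalDimension.
Variables (R : realType) (l : nat) (hl : (2 <= l)%N).
Variables (P : 'M[R]_l) (p : 'rV[R]_l).
Hypotheses (hp : is_prob_vec (p 0)) (hP : stochastic P).
Variable m : probability (measurableTypeR R) R.
Hypothesis hm : markov_driven p P m.

Let p00 i : 0 <= p 0 i. Proof. exact: hp.1. Qed.
Let Pge0 i j : 0 <= P i j. Proof. exact: (hP i).1. Qed.
Let q := word_weight p P.
Let q0 w : 0 <= q w. Proof. exact: word_weight_ge0. Qed.
Let lnl : 0 < ln l%:R :> R. Proof. by rewrite ln_gt0// ltr1n. Qed.

Lemma local_ratio n (w : n.+1.-tuple 'I_l) x : cylinder w x ->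
  (lne (m (adic_interval l n.+1 x)) / lne (lebesgue_measure (adic_interval l n.+1 x)))%E =
  if q w == 0 then +oo%E else (- ln (q w) / (n.+1%:R * ln l%:R))%:E.
Proof.
move=> wx; rewrite (adic_intervalE hl wx) (measure_cylinder hm) lebesgue_cylinder// -/(q w).
have lX : 0 < l%:R ^- n.+1 :> R by rewrite invr_gt0 exprn_gt0// ltr0n ltnW.
have l0 : 0 < l%:R :> R by rewrite ltr0n ltnW.
have nl : 0 < n.+1%:R * ln l%:R :> R by rewrite mulr_gt0.
rewrite (lne_EFin lX) lnV ?posrE ?exprn_gt0// lnXn// -(mulr_natl (ln _)).
rewrite inver oppr_eq0 gt_eqF//; case: ifPn => [/eqP ->|qN].
  by rewrite le0_lneNy// lt0_mulNye// lte_fin invrN oppr_lt0 invr_gt0.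
by rewrite lne_EFin ?lt0r ?qN ?q0// -EFinM invrN mulrN mulNr.
Qed.

(** A bounded error disappears after division by [n]. Only [f n.+1] is constrained, because at
    generation 0 the denominator is [ln 1 = 0]. *)
Lemma local_ratio_cvg (f : nat -> \bar R) (u : nat -> R) (beta C : R) :
  (\forall n \near \oo, f n.+1 = (- u n / (n.+1%:R * ln l%:R))%:E /\
     `|u n - n.+1%:R * beta| <= C) ->
  f n @[n --> \oo] --> (- beta / ln l%:R)%:E.
Proof.
move=> [N _ NP]; rewrite -(@cvg_shiftS _ f).
pose h n := - u n / (n.+1%:R * ln l%:R).
suff : (h n)%:E @[n --> \oo] --> (- beta / ln l%:R)%:E.
  apply: cvg_trans; apply: near_eq_cvg; exists N => // n /= Nn.
  by rewrite (NP n Nn).1.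
apply: cvg_EFin; first exact: nearW.
apply/cvgrPdist_le => e e0 /=.
have C0 : 0 <= C by apply: le_trans (NP N (leqnn N)).2.
pose M := Num.truncn (C / (e * ln l%:R)).
exists (maxn N M) => // n /=; rewrite geq_max => /andP[Nn Mn].
have [_ uC] := NP n Nn; have n0 : 0 < n.+1%:R :> R by [].
have -> : - beta / ln l%:R - h n = (u n - n.+1%:R * beta) / (n.+1%:R * ln l%:R).
  by rewrite /h; field; rewrite !gt_eqF.
rewrite normrM normfV (gtr0_norm (mulr_gt0 n0 lnl)) ler_pdivrMr ?mulr_gt0//.
apply: (le_trans uC); rewrite mulrCA -ler_pdivrMr ?mulr_gt0//.
by apply: ltW; apply: (lt_le_trans (truncnS_gt _)); rewrite ler_nat ltnS.
Qed.

Lemma level_set_infinite_word (e : nat -> 'I_l) (beta C : R) :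
  (forall n, exists2 k, (n <= k)%N & (e k < l.-1)%N) ->
  (forall n, 0 < q (mkseq e n)) ->
  (forall n, `|ln (q (mkseq e n.+1)) - n.+1%:R * beta| <= C) ->
  level_set l m (- beta / ln l%:R) (infinite_word_point R e).
Proof.
move=> he e0 eC; have ce n := infinite_word_point_cylinder R hl n he.
split; first exact: (cylinder_itv01 hl (ce 0%N)).
apply: (@local_ratio_cvg _ (fun n => ln (q (mkseq e n.+1))) beta C).
apply: nearW => n; split => //; rewrite (local_ratio (ce n.+1)) ifF//.
by rewrite gt_eqF//; exact: e0.
Qed.

Lemma monofractal_gibbs s g : 0 <= s -> (forall i, 0 < g i) ->
  gibbs_mx (adic_scale l s) g P -> (forall i j, P i j <> 1) -> monofractal l m.
Proof.
move=> s0 g0 gP PN1.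
have b0 := adic_scale_gt0 hl s.
have [C [c c0 [C0 Cw]]] := word_weight_gibbs b0 hp g0 gP.
pose D := `|ln C| + `|ln c|.
have lnb : ln (adic_scale l s) = - (s * ln l%:R) :> R.
  by rewrite ln_powR lnV ?mulrN// posrE ltr0n ltnW.
have sE : s = - ln (adic_scale l s) / ln l%:R by rewrite lnb opprK mulfK// gt_eqF.
have qD (w : seq 'I_l) : q w != 0 -> `|ln (q w) - (size w)%:R * ln (adic_scale l s)| <= D.
  move=> qN; have qp : 0 < q w by rewrite lt0r qN q0.
  case: (Cw w) => [E|/andP[h1 h2]]; first by rewrite /q E eqxx in qN.
  have bn : 0 < adic_scale l s ^+ size w by rewrite exprn_gt0.
  have lnMX (a : R) : 0 < a -> ln (a * adic_scale l s ^+ size w) =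
      ln a + (size w)%:R * ln (adic_scale l s).
    by move=> a0; rewrite lnM ?posrE// lnXn// mulr_natl.
  have {}h1 : ln (c * adic_scale l s ^+ size w) <= ln (q w).
    by rewrite ler_ln ?posrE// mulr_gt0.
  have {}h2 : ln (q w) <= ln (C * adic_scale l s ^+ size w).
    by rewrite ler_ln ?posrE// mulr_gt0.
  rewrite lnMX// in h1; rewrite lnMX// in h2.
  rewrite ler_norml /D; have := ler_norm (ln C); have := ler_norm (- ln c).
  rewrite normrN; have := normr_ge0 (ln C); have := normr_ge0 (ln c).
  by move: h1 h2 => *; apply/andP; split; lra.
exists s; split.
  (* A row supported on the single letter [l - 1] would have an entry equal to 1. Iterating this
     choice gives an infinite word lying in its own cylinders. *)
  have nxP i : exists j : 'I_l, (j < l.-1)%N /\ 0 < P i j.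
    apply: contrapT => /forallNP H.
    have lm : (l.-1 < l)%N by rewrite prednK// ltnW.
    pose b := Ordinal lm; have := (hP i).2; rewrite (bigD1 b)//= big1 ?addr0 => [|j jb].
      exact: PN1.
    apply/eqP; rewrite eq_le Pge0 andbT leNgt; apply/negP => Pij; apply: (H j); split=> //.
    rewrite ltn_neqAle -ltnS prednK ?ltn_ord ?andbT; last exact: ltnW.
    by apply: contra_neq jb => jb; apply: val_inj.
  have [nx nx_] := choice nxP.
  have [i0 pi0] : exists i, 0 < p 0 i.
    apply: contrapT => /forallNP h; have := hp.2; rewrite big1 => [/eqP|i _].
      by rewrite eq_sym oner_eq0.
    by apply/eqP; rewrite eq_le p00 andbT leNgt; apply/negP/h.
  pose e k := iter k nx i0.
  have e0 n : 0 < q (mkseq e n).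
    case: n => [//|]; elim=> [|n IH]; first by rewrite /q /= mulr1.
    by rewrite /q word_weight_mkseqS mulr_gt0// (nx_ (e n)).2.
  rewrite [X in level_set _ _ X]sE; exists (infinite_word_point R e).
  apply: (@level_set_infinite_word _ _ D) => //.
    by move=> n; exists n.+1 => //; rewrite /e iterS (nx_ _).1.
  move=> n; rewrite -[in X in _ - X](size_mkseq e n.+1); apply: qD.
  by rewrite gt_eqF.
move=> a [x [x01 xa]].
pose w n : n.-tuple 'I_l := sval (cid (cylinder_exists hl n x01)).
have wx n : cylinder (w n) x := svalP (cid (cylinder_exists hl n x01)).
(* A real limit makes the ratios eventually finite, so the cylinders around [x] have positive weight
   and [qD] applies. *)
have /fine_cvgP[[N _ NP] _] := xa.
apply: EFin_inj; rewrite -(cvg_lim (@ereal_hausdorff R) xa); apply/esym/cvg_lim.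
  exact: ereal_hausdorff.
rewrite [X in _ --> X%:E]sE.
apply: (@local_ratio_cvg _ (fun n => ln (q (w n.+1))) _ D).
exists N => // n /= Nn; have := NP n.+1 (leqW Nn); rewrite /= (local_ratio (wx n.+1)).
case: eqP => // /eqP qN _; split => //.
by have := qD _ qN; rewrite size_tuple.
Qed.

End LocalDimension.

Section Cycles.
Variables (R : realType) (l : nat) (hl : (2 <= l)%N).
Variables (P : 'M[R]_l) (p : 'rV[R]_l).
Hypotheses (hp : is_prob_vec (p 0)) (hP : stochastic P) (pP : path_closed P).
Variable m : probability (measurableTypeR R) R.
Hypothesis hm : markov_driven p P m.

Let p00 i : 0 <= p 0 i. Proof. exact: hp.1. Qed.
Let Pge0 i j : 0 <= P i j. Proof. exact: (hP i).1. Qed.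

(** Repeating the cycle multiplies the weight by a fixed factor, so the deviation of its logarithm
    from linear growth is periodic, hence bounded. *)
Lemma cycle_level_set i0 (s : seq 'I_l) :
  0 < p 0 i0 -> last i0 s = i0 -> 0 < path_weight P i0 s ->
  (exists2 j : 'I_l, j \in s & (j < l.-1)%N) ->
  level_set l m (- (ln (path_weight P i0 s) / (size s)%:R) / ln l%:R) !=set0.
Proof.
move=> pi0 si0 s0 [j js jl].
pose k0 := size s; have k00 : (0 < k0)%N by rewrite /k0; case: (s) js.
(* The period is [size s], not [size (i0 :: s)]: the letters at positions 0 and [size s] agree. *)
pose e n := nth i0 (i0 :: s) (n %% k0).
have eD n : e (n + k0)%N = e n by rewrite /e modnDr.
have es : mkseq e k0.+1 = i0 :: s.
  apply: (@eq_from_nth _ i0) => [|n]; rewrite size_mkseq// ltnS => nk.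
  rewrite nth_mkseq ?ltnS// /e; move: nk; rewrite leq_eqVlt => /predU1P[->|nk].
    by rewrite modnn /= /k0 -[RHS]/(nth i0 (i0 :: s) (size s)) (nth_last i0 (i0 :: s)).
  by rewrite modn_small.
pose W := path_weight P i0 s; pose G n := word_weight p P (mkseq e n.+1).
have GS n : G n.+1 = G n * P (e n) (e n.+1) by exact: word_weight_mkseqS.
have G0 : G 0 = p 0 i0 by rewrite /G /= /e mod0n mulr1.
have GD n : G (n + k0)%N = G n * W.
  elim: n => [|n IH]; first by rewrite add0n G0 /G es.
  by rewrite addSn !GS IH -addSn !eD mulrAC.
have GX n : G (n * k0)%N = p 0 i0 * W ^+ n.
  elim: n => [|n IH]; first by rewrite mul0n G0 mulr1.
  by rewrite mulSn addnC GD IH exprSr mulrA.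
have Gp n : 0 < G n.
  rewrite /G; have -> : mkseq e n.+1 = take n.+1 (mkseq e (n * k0).+1).
    rewrite /mkseq -map_take take_iota (minn_idPl _)// ltnS.
    by rewrite leq_pmulr.
  apply: word_weight_take_gt0 => //.
  by rewrite -/(G _) GX mulr_gt0// exprn_gt0.
pose beta := ln W / k0%:R.
have k0N : k0%:R != 0 :> R by rewrite pnatr_eq0 -lt0n.
pose f n := ln (G n) - n.+1%:R * beta.
have fD n : f (n + k0)%N = f n.
  rewrite /f GD lnM ?posrE// -addSn natrD mulrDl [k0%:R * _]mulrC /beta divfK//.
  by ring.
pose C := \sum_(k < k0) `|f k|.
have fC n : `|f n| <= C.
  have -> : f n = f (n %% k0)%N.
    rewrite {1}(divn_eq n k0); elim: (n %/ k0)%N => [|k IH]; first by rewrite mul0n.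
    by rewrite mulSn -addnA addnC fD.
  rewrite /C (bigD1 (Ordinal (ltn_pmod n k00)))//= lerDl sumr_ge0//.
exists (infinite_word_point R e).
apply: (@level_set_infinite_word _ _ hl P p hp hP m hm e beta C) => //; last first.
- by case=> [|n]; [rewrite /= ltr01|exact: Gp].
move=> n; have [r rk rj] : exists2 r, (r <= k0)%N & e r = j.
  have : j \in mkseq e k0.+1 by rewrite es inE js orbT.
  by move=> /mapP[r]; rewrite mem_iota ltnS => /andP[_ rk] ->; exists r.
exists (n * k0 + r)%N; first by rewrite (leq_trans (leq_pmulr n k00))// leq_addr.
rewrite (_ : e _ = j)// -rj; elim: n => // n IH.
by rewrite mulSn -addnA addnC eD.
Qed.

(* All periodic points have the same local dimension, so the weight of a cycle is
   [t ^+ length]; as paths to [j] can all be closed by a common return path, the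
   normalised weight of a path to [j] is a function [g] of [j] only. The return path goes
   through the digit 0, because periodic words ending in (l - 1)(l - 1)... do not code
   points of their own cylinders. *)
Lemma monofractal_cocycle : monofractal l m ->
  exists t, exists2 g : 'I_l -> R, 0 < t & (forall i, 0 < g i) /\ gibbs_mx t g P.
Proof.
move=> [a [_ a_uniq]].
have lnl : 0 < ln l%:R :> R by rewrite ln_gt0// ltr1n.
(* [t = l ^ (- a)], the mean weight per step imposed by the local dimension [a]. *)
pose t := expR (- (a * ln l%:R)); have t0 : 0 < t by exact: expR_gt0.
have [i0 pi0] : exists i, 0 < p 0 i.
  apply: contrapT => /forallNP h; have := hp.2; rewrite big1 => [/eqP|i _].
    by rewrite eq_sym oner_eq0.
  by apply/eqP; rewrite eq_le p00 andbT leNgt; apply/negP/h.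
have cycleE (s : seq 'I_l) : last i0 s = i0 -> 0 < path_weight P i0 s ->
    (exists2 j : 'I_l, j \in s & (j < l.-1)%N) -> path_weight P i0 s = t ^+ size s.
  move=> s1 s2 s3; have aE := a_uniq _ (cycle_level_set pi0 s1 s2 s3).
  have sz : (size s)%:R != 0 :> R by rewrite pnatr_eq0; case: s3 => j; case: (s).
  rewrite /t -expRM_natl aE -[LHS]lnK ?posrE//; congr expR.
  by field; rewrite sz gt_eqF.
pose o := Ordinal (ltnW hl).
have ol : (o < l.-1)%N by rewrite /= -ltnS prednK// ltnW.
have [k Pk] := path_closed_row i0 hl pP.
have [u u0 uo] := path_exists pP k o.
have [v v0 vi] := path_exists pP o i0.
pose c := k :: u ++ v.
have c0 : 0 < path_weight P i0 c by rewrite /= path_weight_cat uo !mulr_gt0.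
have ci : last i0 c = i0 by rewrite /= last_cat uo.
have co : o \in c by rewrite /c -cat_cons mem_cat -uo mem_last.
have [al alP] := choice (fun j => (let: ex_intro2 s s1 s2 := path_exists pP i0 j in
   ex_intro (fun s => 0 < path_weight P i0 s /\ last i0 s = j) s (conj s1 s2))).
have [be beP] := choice (fun j => (let: ex_intro2 s s1 s2 := path_exists pP j i0 in
   ex_intro (fun s => 0 < path_weight P j s /\ last j s = i0) s (conj s1 s2))).
pose A j := path_weight P i0 (al j); pose g j := A j / t ^+ size (al j).
have A0 j : 0 < A j by exact: (alP j).1.
have g0 j : 0 < g j by rewrite divr_gt0// exprn_gt0.
exists t, g => //; split => // i j.
have [->|PN] := eqVneq (P i j) 0; first by left.
right; have Pij : 0 < P i j by rewrite lt0r PN Pge0.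
(* The same return from [j], through the cycle [c], closes both [al j] and [al i] followed by [j].
   Dividing the two cycle identities [E1] and [E2] cancels it and leaves [P i j]. *)
pose Bj := path_weight P j (be j) * path_weight P i0 c.
have Bj0 : 0 < Bj by rewrite mulr_gt0//; exact: (beP j).1.
pose n := (size (be j) + size c)%N.
have E1 : A j * Bj = t ^+ (size (al j) + n).
  rewrite /n -!size_cat -cycleE.
  - by rewrite !path_weight_cat (alP j).2 (beP j).2.
  - by rewrite !last_cat (alP j).2 (beP j).2.
  - by rewrite !path_weight_cat (alP j).2 (beP j).2; exact: mulr_gt0 (A0 j) Bj0.
  - by exists o => //; rewrite !mem_cat co !orbT.
have E2 : A i * (P i j * Bj) = t ^+ (size (al i) + n.+1).
  have wE : path_weight P i0 (al i ++ j :: be j ++ c) = A i * (P i j * Bj).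
    rewrite path_weight_cat (alP i).2 -[path_weight P i _]/(P i j * path_weight P j _).
    by rewrite path_weight_cat (beP j).2.
  have -> : (size (al i) + n.+1 = size (al i ++ j :: be j ++ c))%N.
    by rewrite !size_cat /= size_cat.
  rewrite -cycleE ?wE//.
  - by rewrite last_cat last_cons last_cat (beP j).2.
  - exact: mulr_gt0 (A0 i) (mulr_gt0 Pij Bj0).
  - by exists o => //; rewrite mem_cat in_cons mem_cat co !orbT.
have tX k' : t ^+ k' != 0 by rewrite expf_neq0// gt_eqF.
have AjE : A j = t ^+ size (al j) * t ^+ n / Bj.
  by rewrite -exprD -E1 mulfK// gt_eqF.
have -> : P i j = t ^+ size (al i) * (t * t ^+ n) / (A i * Bj).
  by rewrite -exprS -exprD -E2; field; rewrite !gt_eqF.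
rewrite /g AjE; field; rewrite !tX !gt_eqF//=.
Qed.

End Cycles.

(** * The Parry matrix *)

Lemma parry_mxE (R : realType) (l : nat) (P0 : 'M[R]_l) (v : 'cV[R]_l) (r : R) i j :
  (forall i, 0 < v i 0) ->
  (r^-1 *: (invmx (diag_mx v^T) *m P0 *m diag_mx v^T)) i j =
  P0 i j * (r^-1 * v j 0 / v i 0).
Proof.
move=> v0; pose w : 'rV[R]_l := \row_k (v k 0)^-1.
have D1 : diag_mx v^T *m diag_mx w = 1%:M.
  rewrite mul_diag_mx; apply/matrixP => a b; rewrite !mxE.
  by case: eqP => [->|_]; rewrite ?mulr1n ?mulr0n ?mulr0// divff// gt_eqF.
have [Du _] := mulmx1_unit D1.
have -> : invmx (diag_mx v^T) = diag_mx w by rewrite -[RHS](mulKmx Du) D1 mulmx1.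
by rewrite mul_diag_mx mul_mx_diag !mxE; ring.
Qed.

Lemma lower_dim_le_upper (R : realType) (m : probability (measurableTypeR R) R) :
  (lower_dim m <= upper_dim m)%E.
Proof.
apply: le_ereal_inf => _ [E [mE E1] <-]; exists E => //; split => //.
by rewrite E1 lte01.
Qed.

Section Parry.
Variables (R : realType) (l : nat) (hl : (2 <= l)%N).
Variables (P0 : 'M[R]_l) (P : 'M[R]_l) (v : 'cV[R]_l) (r : R).
Hypotheses (hP0 : forall i j, P0 i j = 0 \/ P0 i j = 1) (hP : stochastic P).
Hypotheses (hP1 : forall i j, P i j <> 1) (PP0 : forall i j, 0 < P0 i j <-> 0 < P i j).
Hypotheses (r0 : 0 < r) (v0 : forall i, 0 < v i 0) (P0v : P0 *m v = r *: v).

Let Q := r^-1 *: (invmx (diag_mx v^T) *m P0 *m diag_mx v^T).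
Let QE i j : Q i j = P0 i j * (r^-1 * v j 0 / v i 0).
Proof. exact: parry_mxE. Qed.

Let P00 i j : 0 <= P0 i j. Proof. by case: (hP0 i j) => ->. Qed.
Let c0 i j : 0 < r^-1 * v j 0 / v i 0.
Proof. by rewrite divr_gt0// mulr_gt0// invr_gt0. Qed.

Lemma parry_gibbs : gibbs_mx r^-1 (fun i => v i 0) Q.
Proof. by move=> i j; rewrite QE; case: (hP0 i j) => ->; rewrite ?mul0r ?mul1r; [left|right]. Qed.

Lemma parry_support i j : 0 < P i j <-> 0 < Q i j.
Proof. by rewrite -PP0 QE pmulr_lgt0. Qed.

Lemma parry_stochastic : stochastic Q.
Proof.
move=> i; split=> [j|]; first by rewrite QE mulr_ge0// ltW.
have /matrixP/(_ i 0) := P0v; rewrite !mxE => E.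
have -> : \sum_j Q i j = (\sum_j P0 i j * v j 0) * (r^-1 / v i 0).
  by rewrite mulr_suml; apply: eq_bigr => j _; rewrite QE; ring.
by rewrite E; field; rewrite !gt_eqF.
Qed.

(** At a state [i] minimising [v], the row of [P0] has at least two entries 1, since no entry of [P]
    is 1; hence [r * v i 0] is at least [2 * v i 0]. *)
Lemma perron_ge2 : 2 <= r.
Proof.
have i0 : 'I_l by exact: Ordinal (ltnW hl).
pose i := [arg min_(i < i0) v i 0]%O.
have imin j : v i 0 <= v j 0 by rewrite /i; case: arg_minP => // k _ kP; apply: kP.
have [j Pij] : exists j, 0 < P i j.
  apply: contrapT => /forallNP h; have := (hP i).2; rewrite big1 => [/eqP|j _].
    by rewrite eq_sym oner_eq0.
  by apply/eqP; rewrite eq_le (hP i).1 andbT leNgt; apply/negP/h.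
have [k kj Pik] : exists2 k, k != j & 0 < P i k.
  apply: contrapT => H; apply: (hP1 (i := i) (j := j)).
  have := (hP i).2; rewrite (bigD1 j)//= big1 ?addr0// => k kj.
  apply/eqP; rewrite eq_le (hP i).1 andbT leNgt; apply/negP => Pik.
  by apply: H; exists k.
have one h : 0 < P i h -> P0 i h = 1.
  by move=> /PP0; case: (hP0 i h) => ->//; rewrite ltxx.
have /matrixP/(_ i 0) := P0v; rewrite !mxE (bigD1 j)//= (bigD1 k)//= !one// !mul1r => E.
rewrite -(ler_pM2r (v0 i)) -E.
have : 0 <= \sum_(h < l | (h != j) && (h != k)) P0 i h * v h 0.
  by rewrite sumr_ge0// => h _; rewrite mulr_ge0// ltW.
by move: (imin j) (imin k) => *; lra.
Qed.

Lemma parry_of_gibbs (y : 'cV[R]_l) t (g : 'I_l -> R) : path_closed P0 ->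
  (forall i, 0 < y i 0) -> P0^T *m y = r *: y -> \sum_i v i 0 = 1 ->
  0 < t -> (forall i, 0 < g i) -> gibbs_mx t g P -> P = Q.
Proof.
move=> pP0 y0 P0y v1 t0 g0 gP.
have PE i j : P i j = P0 i j * (t * g j / g i).
  have tg : 0 < t * g j / g i by rewrite divr_gt0// mulr_gt0.
  case: (hP0 i j) => E; rewrite E ?mul0r ?mul1r.
    apply/eqP; rewrite eq_le (hP i).1 andbT leNgt; apply/negP => /PP0.
    by rewrite E ltxx.
  case: (gP i j) => // Pij; have /PP0 : 0 < P0 i j by rewrite E.
  by rewrite Pij ltxx.
pose G := \sum_i g i.
have i0 : 'I_l by exact: Ordinal (ltnW hl).
have G0 : 0 < G.
  by rewrite /G (bigD1 i0)//= ltr_pwDl// sumr_ge0// => j _; exact: ltW.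
pose w : 'cV[R]_l := \col_i (g i / G).
have w0 i : 0 < w i 0 by rewrite mxE divr_gt0.
have P0w : P0 *m w = t^-1 *: w.
  apply/colP => i; rewrite !mxE; under eq_bigr do rewrite mxE.
  have -> : \sum_j P0 i j * (g j / G) = (\sum_j P i j) * (g i / (t * G)).
    rewrite mulr_suml; apply: eq_bigr => j _; rewrite PE; field.
    by rewrite !gt_eqF.
  by rewrite (hP i).2; field; rewrite !gt_eqF.
have wN0 : w != 0.
  by apply/eqP => /matrixP/(_ i0 0)/eqP; rewrite [X in _ == X]mxE gt_eqF.
(* Row sums 1 of [P] made [w] an eigenvector for [t^-1]; positivity forces the Perron eigenvalue. *)
have tr : t^-1 = r := eigenvalue_dual (fun i => ltW (w0 i)) wN0 y0 P0w P0y.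
rewrite tr in P0w.
have w1 : \sum_i w i 0 = 1.
  by under eq_bigr do rewrite mxE; rewrite -mulr_suml divff// gt_eqF.
have vw := perron_unique P00 pP0 v0 w0 P0v P0w v1 w1.
apply/matrixP => i j; rewrite QE vw PE -tr invrK !mxE.
by congr (_ * _); field; rewrite !gt_eqF.
Qed.

End Parry.

Theorem theorem5p5 (R : realType) (l : nat) (hl : (2 <= l)%N)
    (P0 : 'M[R]_l) (hP0 : forall i j, P0 i j = 0 \/ P0 i j = 1)
    (hP0irr : irreducible_mx P0)
    (p0 : 'rV[R]_l) (hp0 : forall i, p0 0 i = 0 \/ p0 0 i = 1)
    (hp0nz : p0 <> 0)
    (p : 'rV[R]_l) (hp : is_prob_vec (p 0))
    (P : 'M[R]_l) (hP : stochastic P) (hP1 : forall i j, P i j <> 1)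
    (hPirr : irreducible_mx P)
    (m : probability (measurableTypeR R) R) (hm : markov_driven p P m)
    (hsupp : measure_support m = markov_compact p0 P0) :
  let lambda0 := spectral_radius P0 in
  exists2 pi0 : 'cV[R]_l,
    unique (fun v : 'cV[R]_l =>
              is_prob_vec (fun i => v i 0) /\ P0 *m v = lambda0 *: v) pi0 &
    let D0 := diag_mx pi0^T in
    (is_dim m (hausdorff_dim (markov_compact p0 P0)) <->
       P = lambda0^-1 *: (invmx D0 *m P0 *m D0)) /\
    (monofractal l m <-> P = lambda0^-1 *: (invmx D0 *m P0 *m D0)).
Proof.
move=> lambda0.
have P00 i j : 0 <= P0 i j by case: (hP0 i j) => ->.
have Pge0 i j : 0 <= P i j := (hP i).1 j.
have p00 i : 0 <= p 0 i := hp.1 i.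
have pP0 := irreducible_path_closed P00 hP0irr.
have pP := irreducible_path_closed Pge0 hPirr.
have [r [u [y [r0 u0 y0 P0u P0y]]]] := perron hl P00 pP0.
have lr : lambda0 = r := spectral_radius_perron (ltnW hl) P00 r0 u0 y0 P0u P0y.
pose U := \sum_i u i 0.
have i0 : 'I_l by exact: Ordinal (ltnW hl).
have U0 : 0 < U.
  by rewrite /U (bigD1 i0)//= ltr_pwDl// sumr_ge0// => j _; exact: ltW.
pose v := U^-1 *: u.
have v0 i : 0 < v i 0 by rewrite mxE mulr_gt0// invr_gt0.
have v1 : \sum_i v i 0 = 1.
  by under eq_bigr do rewrite mxE; rewrite -mulr_sumr mulVf// gt_eqF.
have P0v : P0 *m v = r *: v by rewrite /v -scalemxAr P0u !scalerA mulrC.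
rewrite lr; exists v.
  split; first by split=> //; split=> // i; exact: ltW.
  move=> w [[w0 w1] P0w].
  have wN0 : w != 0.
    apply/eqP => w00; move: w1; rewrite big1 => [/eqP|i _]; first by rewrite eq_sym oner_eq0.
    by rewrite w00 mxE.
  exact: perron_unique P00 pP0 v0 (eigvec_pos P00 pP0 w0 wN0 P0w) P0v P0w v1 w1.
move=> D0; rewrite /D0 {D0}.
set Q := r^-1 *: _.
have PP0 := support_transition hl hP0 hp0 pP0 hp hP pP hm hsupp hp0nz.
have gQ : gibbs_mx r^-1 (fun i => v i 0) Q by exact: parry_gibbs.
have hQ : stochastic Q by exact: parry_stochastic.
have PQ : forall i j, 0 < P i j <-> 0 < Q i j by move=> i j; exact: parry_support.
have r2 : 2 <= r by apply: (perron_ge2 hl hP0 hP hP1 PP0 v0 P0v).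
have lnl : 0 < ln l%:R :> R by rewrite ln_gt0// ltr1n.
pose s := ln r / ln l%:R.
have s0 : 0 < s by rewrite divr_gt0// ln_gt0// (lt_le_trans _ r2)// ltr1n.
have bE : adic_scale l s = r^-1.
  rewrite /adic_scale /powR gt_eqF ?invr_gt0 ?ltr0n ?(ltnW hl)//.
  by rewrite lnV ?posrE ?ltr0n ?(ltnW hl)// mulrN divfK ?gt_eqF// expRN lnK.
rewrite -bE in gQ.
(* The weights of [Q] are started from the initial law [p] of [m], so allowed words are compared
   through [P]. *)
have wQ w : word_weight p0 P0 w = 1 <-> 0 < word_weight p Q w.
  apply: (@iff_trans _ (0 < word_weight p P w)).
    case/lastP: w => [|w i]; first by split.
    exact: (support_word hl hP0 hp0 pP0 hp hP pP hm hsupp).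
  split; first by apply: word_weight_support => // i j /PQ.
  by apply: word_weight_support => // [i j|i j /PQ//]; exact: (hQ i).1.
have dimK := hausdorff_dim_markov_compact hl (ltW s0) v0 hp hQ gQ wQ.
rewrite dimK; split.
  split=> [[_ dimE]|PE].
    apply: contrapT => PNQ.
    have [s' [kappa [C [/andP[s'0 s's] k01 light]]]] :=
      light_words hl hp hP hQ PQ pP s0 v0 gQ PNQ.
    have := upper_dim_le hl hp hP hm s'0 ltr01 k01 light.
    by rewrite dimE lee_fin leNgt s's.
  rewrite -PE in gQ.
  have lo := lower_dim_ge hl hp hm (ltW s0) v0 gQ.
  have up : (upper_dim m <= s%:E)%E.
    (* With the lower Gibbs constant [c] as threshold, a light word has weight 0, so the mass bound
       holds with both constants equal to 0. *)
    have [C [c c0 [C0 Cw]]] := word_weight_gibbs (adic_scale_gt0 hl s) hp v0 gQ.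
    apply: (@upper_dim_le _ _ hl P p hp hP m hm s c 0 0) => //; first exact: ltW.
      by rewrite lexx ltr01.
    move=> n; rewrite mul0r big1// => w; case: (Cw w) => [//|/andP[+ _]].
    by rewrite size_tuple leNgt => /negbTE ->.
  have lu := lower_dim_le_upper m.
  split; apply/eqP; rewrite eq_le; apply/andP; split => //.
    exact: le_trans lu up.
  exact: le_trans lo lu.
split=> [mono|PE].
  have [t [g t0 [g0 gP]]] := monofractal_cocycle hl hp hP pP hm mono.
  exact: (parry_of_gibbs hl hP0 hP PP0 v0 P0v pP0 y0 P0y v1 t0 g0 gP).
rewrite -PE in gQ.
exact: (monofractal_gibbs hl hp hP hm (ltW s0) v0 gQ hP1).
Qed.
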